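(* Let $v,w\in\mathfrak{S}_n$ with $v\le w$ in Bruhat order, and suppose that the Bruhat interval polytope $Q_{v,w}$ is toric. Then $Q_{v,w}$ is a simple polytope if and only if it is combinatorially equivalent to a cube.
   Context: $\mathfrak{S}_n$ is the symmetric group on $\{1,\dots,n\}$, $\ell(\cdot)$ is the length with respect to the simple transpositions $s_i=(i,i+1)$, and $\le$ is Bruhat order. For $v\le w$, $[v,w]=\{z\in\mathfrak{S}_n\mid v\le z\le w\}$, and the Bruhat interval polytope $Q_{v,w}$ is the convex hull in $\mathbb{R}^n$ of the points $(z(1),\dots,z(n))$ for $z\in[v,w]$. $Q_{v,w}$ is called toric if $\dim Q_{v,w}=\ell(w)-\ell(v)$. A $d$-dimensional polytope is simple if each of its vertices lies on exactly $d$ edges. Two polytopes are combinatorially equivalent if their face posets are isomorphic. *)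

(* Defs.v *)
From HB Require Import structures.
From mathcomp Require Import all_boot all_order all_fingroup all_algebra.

Set Implicit Arguments.
Unset Strict Implicit.
Unset Printing Implicit Defensive.

Section SymmetricGroup.
Local Open Scope group_scope.
Variable n : nat.
Implicit Types (v w z : 'S_n) (i j : 'I_n).

(* The letters {1, ..., n} are the ordinals of 'I_n shifted by one. *)
Definition simple_transp : {set 'S_n} :=
  [set s | [exists i : 'I_n, exists j : 'I_n,
              (j == i.+1 :> nat) && (s == tperm i j)]].

Lemma tperm_gen_simple i j : tperm i j \in <<simple_transp>>.
Proof.
wlog lt_ij : i j / i < j.
  move=> H; case: (ltngtP i j) => [|lt_ji|/val_inj->]; first exact: H.
  - by rewrite tpermC; apply: H.
  - by rewrite tperm1 group1.
have [m] := ubnP j; elim: m => // m IHm in j lt_ij * => lt_jm.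
have [ji|ji] := eqVneq (j : nat) i.+1.
  rewrite mem_gen // inE; apply/existsP; exists i; apply/existsP; exists j.
  by rewrite ji !eqxx.
have lt_ij1 : i < j.-1.
  by rewrite -ltnS (ltn_predK lt_ij) ltn_neqAle eq_sym ji.
have lt_j1n : j.-1 < n by apply: leq_ltn_trans (leq_pred _) (ltn_ord j).
pose k := Ordinal lt_j1n.
have kj : k.+1 = j by rewrite /= (ltn_predK lt_ij).
have -> : tperm i j = tperm i k ^ tperm k j.
  by rewrite tpermJ tpermL tpermD // -val_eqE /= ?gtn_eqF // -kj /= -/k kj.
apply: groupJ; first by apply: IHm => //=; rewrite -ltnS; apply: leq_trans lt_jm; rewrite ltnS -kj.
rewrite mem_gen // inE; apply/existsP; exists k; apply/existsP; exists j.
by rewrite kj !eqxx.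
Qed.

(* simple_transp ^+ k is the set of products of k simple transpositions. *)
Lemma ex_word w : exists k, w \in simple_transp ^+ k.
Proof.
have /gen_prodgP[k [c cS ->]] : w \in <<simple_transp>>.
  have [ts -> _] := prod_tpermP w.
  by apply: group_prod => t _; apply: tperm_gen_simple.
by exists k; rewrite -[k in _ ^+ k]card_ord -prodg_const; apply: mem_prodg.
Qed.

Definition perm_length w : nat := ex_minn (ex_word w).

(* One upward step of Bruhat order.  The transpositions form a conjugacy
   class, so multiplying by them on the left or on the right is the same. *)
Definition bruhat_step : rel 'S_n :=
  [rel v w | [exists i : 'I_n, exists j : 'I_n, w == tperm i j * v]
             && (perm_length v < perm_length w)].

Definition bruhat_le : rel 'S_n := connect bruhat_step.

Definition bruhat_interval v w : {set 'S_n} :=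
  [set z | bruhat_le v z && bruhat_le z w].

End SymmetricGroup.

From mathcomp Require Import all_classical all_reals.

Import Order.TTheory GRing.Theory Num.Theory.
Local Open Scope ring_scope.
Local Open Scope classical_set_scope.
Local Open Scope card_scope.

Section Polytopes.
Variable R : realType.

Definition conv_hull n (S : set 'rV[R]_n) : set 'rV[R]_n :=
  [set x | exists k (p : 'I_k -> 'rV[R]_n) (a : 'I_k -> R),
     [/\ forall i, S (p i), forall i, 0 <= a i,
         \sum_i a i = 1 & x = \sum_i a i *: p i]].

Definition aff_hull n (S : set 'rV[R]_n) : set 'rV[R]_n :=
  [set x | exists k (p : 'I_k -> 'rV[R]_n) (a : 'I_k -> R),
     [/\ forall i, S (p i), \sum_i a i = 1 & x = \sum_i a i *: p i]].

(* The dimension as a relation, which holds for no d when S is empty. *)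
Definition has_dim n (S : set 'rV[R]_n) (d : nat) : Prop :=
  exists (x0 : 'rV[R]_n) (U : {vspace 'rV[R]_n}),
    \dim U = d /\ aff_hull S = [set x0 + u | u in [set` U]].

Definition dotr n (c x : 'rV[R]_n) : R := \sum_i c 0 i * x 0 i.

(* P itself (c = 0, b = 0) and the empty set (c = 0, b = 1) are faces. *)
Definition is_face n (P F : set 'rV[R]_n) : Prop :=
  exists (c : 'rV[R]_n) (b : R),
    (forall x, P x -> dotr c x <= b) /\ F = P `&` [set x | dotr c x = b].

Definition is_vertex n (P : set 'rV[R]_n) (x : 'rV[R]_n) : Prop :=
  is_face P [set x].

Definition is_edge n (P E : set 'rV[R]_n) : Prop :=
  is_face P E /\ has_dim E 1.

Definition is_simple n (P : set 'rV[R]_n) : Prop :=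
  exists d, has_dim P d /\
    forall x, is_vertex P x -> [set E | is_edge P E /\ E x] #= `I_d.

Definition comb_equiv n m (P : set 'rV[R]_n) (Q : set 'rV[R]_m) : Prop :=
  exists phi : set 'rV[R]_n -> set 'rV[R]_m,
    set_bij [set F | is_face P F] [set G | is_face Q G] phi /\
    forall F G, is_face P F -> is_face P G -> (F `<=` G <-> phi F `<=` phi G).

Definition cube d : set 'rV[R]_d := [set x | forall i, 0 <= x 0 i <= 1].

Definition perm_point n (z : 'S_n) : 'rV[R]_n := \row_i (z i).+1%:R.

Definition bruhat_polytope n (v w : 'S_n) : set 'rV[R]_n :=
  conv_hull [set perm_point z | z in [set` bruhat_interval v w]].

(* The truncated subtraction is exact when v <= w in Bruhat order. *)
Definition is_toric n (v w : 'S_n) : Prop :=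
  has_dim (bruhat_polytope v w) (perm_length w - perm_length v).

End Polytopes.

Arguments cube R d : clear implicits.
Arguments bruhat_polytope R {n} v w.

(* Main.v *)
(* Write [v <= z] for Bruhat order and identify [z] with the point [(z 1, ..., z n)].
   Two facts about an arbitrary interval [[v, w]] do most of the work.
   (1) [w - v] is a nonnegative combination of the vectors [a - v], for the atoms
   [a] of [[v, w]] (the covers of [v] below [w]).
   (2) The direction space [Dir v w] of [[v, w]] is the sum of the line of [a - v]
   and of [Dir a w], for every atom [a]; hence [dim (Dir v w) <= l w - l v], and in
   the toric case [Dir v w] is the direct sum of [Dir v z] and [Dir z w] for all [z]
   of the interval, all the subintervals being toric.
   By (1) and an explicit functional every atom spans an edge at [v], so a simple
   toric polytope has exactly [l w - l v] atoms. Directness then makes distinct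
   covers of [z] acquire distinct new atoms, and a count of the covers shows that
   sending [z] to the set of atoms below it is an isomorphism from [[v, w]] to a
   Boolean lattice. Requiring or forbidding an atom cuts out a facet, so the faces
   are those of a cube.
   Conversely the face lattice of a polytope determines the dimensions of its
   faces, because facets exist and dimension is strictly monotone; thus a polytope
   combinatorially equivalent to a cube is simple. *)

Require Import Defs.
From mathcomp Require Import all_boot all_order all_fingroup all_algebra.
From mathcomp Require Import zify.

Set Implicit Arguments.
Unset Strict Implicit.
Unset Printing Implicit Defensive.

(** * Inversions and the rank description of Bruhat order *)

Section Inversions.
Local Open Scope group_scope.
Variable n : nat.
Implicit Types (v w x y z : 'S_n) (i j k l m : 'I_n).

(** Both facts come from intervals of length two: a chain from [v] through [x] to [y] is traded for
    another chain by relations between two transpositions, and the trade is read on the vectors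
    [root i j]. The trades wanted differ. Fact (1) needs nonnegative coefficients, so the starting
    atom must be chosen extremally; fact (2) only compares spans, so it suffices to link every atom
    to one fixed atom. Rank counts enter because they produce a cover towards [w] at a prescribed
    position, the first one where [v] and [w] differ. Linear algebra alone does not finish. All the
    points lie on one sphere about the origin, which forbids three collinear points and makes each
    quadrilateral of the interval bulge outwards at its top. The latter is what the facets requiring
    an atom need. Those forbidding an atom come directly from a dual basis; the two kinds are not
    exchanged by symmetry, since simplicity is exploited at the bottom vertex only. *)

Definition ninv v : nat := \sum_(a < n) \sum_(b < n) ((a < b) && (v b < v a)).

Lemma sum_split2 (F : 'I_n -> nat) i j : i != j ->
  \sum_a F a = (F i + F j + \sum_(a | (a != i) && (a != j)) F a)%N.
Proof.
by move=> nij; rewrite (bigD1 i) //= (bigD1 j) ?(eq_sym j) //= addnA.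
Qed.

Lemma sum2_split2 (E : 'I_n -> 'I_n -> nat) i j : i != j ->
  \sum_a \sum_b E a b =
    (\sum_(a | (a != i) && (a != j)) \sum_(b | (b != i) && (b != j)) E a b
    + \sum_(m | (m != i) && (m != j)) (E i m + E j m + E m i + E m j)
    + (E i i + E i j + E j i + E j j))%N.
Proof.
move=> nij; rewrite (sum_split2 _ nij) !(sum_split2 (E _) nij).
under [X in (_ + X)%N = _]eq_bigr do rewrite (sum_split2 _ nij).
rewrite !big_split /=; lia.
Qed.

(** The pair [(i, j)] becomes an inversion. For a third position [m], the inversions formed with [i]
    and [j] keep their total number unless [m] lies between them both in position and in value, when
    two are gained. *)
Lemma ninv_tperm v i j : i < j -> v i < v j ->
  ninv (tperm i j * v) =
    (ninv v + 1 + 2 * \sum_(m < n) ((i < m < j) && (v i < v m < v j)))%N.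
Proof.
move=> ij vij; have nij : i != j by rewrite -val_eqE /= ltn_eqF.
rewrite /ninv (sum2_split2 _ nij) [in RHS](sum2_split2 _ nij).
rewrite [X in (2 * X)%N](sum_split2 _ nij).
rewrite !permM tpermL tpermR !ltnn /= ?add0n.
have -> : (j < i) = false by lia.
have -> : (v j < v i) = false by lia.
rewrite ij vij /= ?andbF ?addn0 ?add0n.
rewrite big_distrr /=.
set A := (\sum_(a | _) _)%N; set B := (\sum_(a | _) _)%N; set C := (\sum_(a | _) _)%N.
set D := (\sum_(a | _) _)%N; set F := (\sum_(a | _) _)%N.
have -> : A = C.
  apply: eq_bigr => a /andP[ai aj]; apply: eq_bigr => b /andP[bi bj].
  by rewrite !permM !tpermD // eq_sym.
suff -> : B = (D + F)%N by lia.
rewrite -big_split /=; apply: eq_bigr => m /andP[mi mj].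
rewrite !permM !tpermD 1?eq_sym //.
have vmi : v m != v i :> nat by rewrite val_eqE (inj_eq perm_inj).
have vmj : v m != v j :> nat by rewrite val_eqE (inj_eq perm_inj).
rewrite -!val_eqE /= in mi mj *; lia.
Qed.

Lemma ninv_tperm_lt v i j : i < j -> v i < v j -> ninv v < ninv (tperm i j * v).
Proof. by move=> ij vij; rewrite ninv_tperm //; lia. Qed.

Lemma tpermMK v i j : tperm i j * (tperm i j * v) = v.
Proof. by rewrite mulgA tperm2 mul1g. Qed.

Lemma ninv1 : ninv 1 = 0%N.
Proof.
rewrite /ninv big1 // => a _; rewrite big1 // => b _; rewrite !perm1; lia.
Qed.

Lemma ninv_simple s v : s \in simple_transp n -> ninv (s * v) <= (ninv v).+1.
Proof.
rewrite inE => /existsP[i /existsP[j /andP[/eqP ji /eqP->]]].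
have ij : i < j by rewrite ji.
have nij : i != j by rewrite -val_eqE /= ltn_eqF.
have H (u : 'S_n) : u i < u j -> ninv (tperm i j * u) = (ninv u).+1.
  move=> uij; rewrite ninv_tperm // big1 ?muln0 ?addn0 ?addn1 // => m _; lia.
have [vij|vji] := ltnP (v i) (v j); first by rewrite H.
have := H (tperm i j * v); rewrite tpermMK !permM tpermL tpermR.
rewrite ltn_neqAle vji andbT val_eqE (inj_eq perm_inj) eq_sym => /(_ nij) ->.
by rewrite -addn2 leq_addr.
Qed.

(** Ascents everywhere force [i <= v i], and positions and values have the same sum, so all these
    inequalities are equalities. *)
Lemma perm_no_descent v :
  (forall i j, j = i.+1 :> nat -> v i < v j) -> v = 1.
Proof.
move=> asc.
have ge (k : nat) : forall i, i = k :> nat -> i <= v i.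
  elim: k => [|k IH] i ik; first by rewrite ik.
  have kn : k < n by apply: ltn_trans (ltn_ord i); rewrite ik.
  by have /= := IH (Ordinal kn) erefl; have /= := asc (Ordinal kn) i ik; lia.
have eqv : \sum_(i < n) (i : nat) == \sum_(i < n) (v i : nat).
  rewrite [X in _ == X](reindex_inj (@perm_inj _ v^-1)) /=.
  by under [X in _ == X]eq_bigr do rewrite permKV.
have := leqif_sum (fun i (_ : true) => leqif_eq (ge _ i erefl)).
move=> [_]; rewrite eqv => /esym/forallP eqi.
by apply/permP => i; rewrite perm1; apply/val_inj/esym/eqP/(eqi i).
Qed.

(** Undoing an adjacent descent costs one letter and removes exactly one inversion, which bounds the
    length above; conversely a letter creates at most one inversion. *)
Lemma perm_lengthE v : perm_length v = ninv v.
Proof.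
rewrite /perm_length; case: ex_minnP => k wk kmin; apply/eqP; rewrite eqn_leq.
apply/andP; split.
  apply: kmin; have [N] := ubnP (ninv v); elim: N v {wk} => // N IH v lt_vN.
  have [->|v1] := eqVneq v 1; first by rewrite ninv1 expg0 inE.
  have /existsP[i /existsP[j /andP[/eqP ji vji]]] :
      [exists i : 'I_n, exists j : 'I_n, (j == i.+1 :> nat) && (v j < v i)].
    apply: contraT => /existsPn nd; case/eqP: v1.
    apply: perm_no_descent => i j ji; have /existsPn/(_ j) := nd i.
    rewrite ji eqxx /= -leqNgt leq_eqVlt => /orP[/eqP/val_inj/perm_inj ij|//].
    by move: ji; rewrite ij; lia.
  have ij : i < j by rewrite ji.
  have vt : (tperm i j * v)%g i < (tperm i j * v)%g j by rewrite !permM tpermL tpermR.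
  have E : ninv v = (ninv (tperm i j * v)).+1.
    rewrite -{1}(tpermMK v i j) ninv_tperm // big1 ?muln0 ?addn0 ?addn1 // => m _; lia.
  rewrite E expgS -[X in X \in _](tpermMK v i j); apply: mem_mulg; last by apply: IH; lia.
  by rewrite inE; apply/existsP; exists i; apply/existsP; exists j; rewrite ji !eqxx.
elim: k v wk {kmin} => [|k IH] v; first by rewrite expg0 => /set1P->; rewrite ninv1.
rewrite expgS => /mulsgP[s u ss /IH uk ->].
by apply: leq_trans (ninv_simple u ss) _.
Qed.

Lemma bruhat_stepP v w :
  reflect (exists i j, [/\ i < j, v i < v j & w = tperm i j * v])
          (bruhat_step v w).
Proof.
rewrite /bruhat_step /= !perm_lengthE.
apply: (iffP andP) => [[/existsP[i /existsP[j /eqP->]] lt]|]; last first.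
  move=> [i [j [ij vij ->]]]; split; last exact: ninv_tperm_lt.
  by apply/existsP; exists i; apply/existsP; exists j.
wlog ij : i j lt / i < j.
  move=> W; have [/(W _ _ lt)//|/(W j i)|/val_inj ij] := ltngtP i j.
    by rewrite tpermC => /(_ lt).
  by move: lt; rewrite ij tperm1 mul1g ltnn.
have nij : i != j by rewrite -val_eqE /= ltn_eqF.
exists i, j; split=> //; rewrite ltnNge leq_eqVlt; apply/negP => /orP[/eqP/val_inj/perm_inj ji|vji].
  by rewrite ji eqxx in nij.
have := @ninv_tperm_lt (tperm i j * v) i j ij; rewrite tpermMK !permM tpermL tpermR.
by move=> /(_ vji); lia.
Qed.

Lemma bruhat_le_refl v : bruhat_le v v. Proof. exact: connect0. Qed.

Lemma bruhat_le_trans y x z : bruhat_le x y -> bruhat_le y z -> bruhat_le x z.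
Proof. exact: connect_trans. Qed.

Lemma bruhat_le_tperm v i j : i < j -> v i < v j -> bruhat_le v (tperm i j * v).
Proof. by move=> ij vij; apply/connect1/bruhat_stepP; exists i, j. Qed.

Lemma bruhat_le_ind (P : 'S_n -> Prop) v :
  P v ->
  (forall u i j, bruhat_le v u -> P u -> i < j -> u i < u j -> P (tperm i j * u)) ->
  forall w, bruhat_le v w -> P w.
Proof.
move=> Pv step w /connectP[p]; elim/last_ind: p w => [|p u IH] w /=.
  by move=> _ ->.
rewrite rcons_path last_rcons => /andP[pth /bruhat_stepP[i [j [ij vij E]]]] ->.
rewrite E; apply: step => //; last exact: IH.
by apply/connectP; exists p.
Qed.

Lemma bruhat_le_ninv v w : bruhat_le v w -> (ninv v < ninv w) || (v == w).
Proof.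
move: w; apply: bruhat_le_ind => [|u i j _ H ij uij]; first by rewrite eqxx orbT.
by have := ninv_tperm_lt ij uij; case/orP: H => [|/eqP<-]; lia.
Qed.

Lemma bruhat_le_anti v w : bruhat_le v w -> bruhat_le w v -> v = w.
Proof. by move=> /bruhat_le_ninv/orP[A|/eqP//] /bruhat_le_ninv/orP[|/eqP//]; lia. Qed.

(* Bruhat order is the pointwise order on these counts: see [bruhat_le_rk] and
   [rk_bruhat_le]. *)
Definition rk v (p q : nat) : nat := \sum_(k < n) ((k < p) && (q <= v k)).

Lemma rk_tperm v i j p q : i < j -> v i < v j ->
  rk (tperm i j * v) p q = (rk v p q + ((i < p <= j) && (v i < q <= v j)))%N.
Proof.
move=> ij vij; have nij : i != j by rewrite -val_eqE /= ltn_eqF.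
rewrite /rk !(sum_split2 _ nij) !permM tpermL tpermR.
rewrite (eq_bigr (fun k : 'I_n => ((k < p) && (q <= v k)) : nat)); first by set S := bigop _ _ _; lia.
by move=> a /andP[ai aj]; rewrite permM tpermD // eq_sym.
Qed.

Lemma bruhat_le_rk v w : bruhat_le v w -> forall p q, rk v p q <= rk w p q.
Proof.
move: w; apply: bruhat_le_ind => // u i j _ H ij uij p q.
by rewrite rk_tperm // (leq_trans (H p q)) // leq_addr.
Qed.

(** At [p = i.+1] and [q = v i] the positions before [i] count equally on both sides, so position
    [i], counted for [v], must be counted for [w]. *)
Lemma rk_le_first v w i : (forall p q, rk v p q <= rk w p q) ->
  (forall m, m < i -> v m = w m) -> v i <= w i.
Proof.
move=> le_vw eq_lt; have := le_vw i.+1 (v i).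
rewrite /rk (bigD1 i) //= [leqRHS](bigD1 i) //= ltnSn leqnn /=.
rewrite (eq_bigr (fun k : 'I_n => ((k < i.+1) && (v i <= w k)) : nat)); last first.
  move=> k ki; have [lt_ki|] := ltnP k i; first by rewrite (eq_lt k).
  by move: ki; rewrite -val_eqE /=; lia.
by set S := bigop _ _ _; lia.
Qed.

Lemma exists_first_diff v w : v != w ->
  exists i, v i != w i /\ forall m, m < i -> v m = w m.
Proof.
move=> nvw; have /existsP[i0 Pi0] : [exists i, v i != w i].
  apply: contraT => /existsPn H; case/eqP: nvw; apply/permP => i.
  by have := H i; rewrite negbK => /eqP.
case: (@arg_minnP _ i0 (fun i => v i != w i) (fun i => i : nat) Pi0) => i Pi imin.
exists i; split=> // m lt_mi; apply/eqP; apply: contraTT lt_mi => /imin.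
by rewrite -leqNgt.
Qed.

Lemma exists_first_swap v w i : (forall p q, rk v p q <= rk w p q) ->
    (forall m, m < i -> v m = w m) -> v i != w i ->
  exists j, [/\ i < j, v i < v j <= w i
             & forall m, i < m < j -> ~~ (v i < v m <= w i)].
Proof.
move=> le_vw eq_lt ne_i; have le_i := rk_le_first le_vw eq_lt.
pose P := [pred j : 'I_n | (i < j) && (v i < v j <= w i)].
(* The position of the value [w i] in [v] is a candidate: it lies after [i], as [v] and [w] agree
   before [i]. *)
have Pj0 : P (v^-1 (w i)).
  have lt_i : v i < w i by rewrite ltn_neqAle le_i andbT.
  rewrite /= permKV leqnn lt_i !andbT ltnNge; apply/negP; rewrite leq_eqVlt => /orP[/eqP/val_inj E|lt].
    by case/eqP: ne_i; rewrite -{1}E permKV.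
  have := eq_lt _ lt; rewrite permKV => /perm_inj E.
  by rewrite -E ltnn in lt.
case: (@arg_minnP _ _ P (fun i => i : nat) Pj0) => j /andP[ij vij] jmin.
exists j; split=> // m /andP[im mj]; apply: contraTN mj => vm.
by rewrite -leqNgt; apply: jmin; rewrite /= im.
Qed.

(** The count of [v] grows only for [i < p <= j] and [v i < q <= v j]. There, split the counts at
    the height [w i]: above it the hypothesis applies, and below it position [i] counts for [w] but
    not for [v], while by the choice of [j] the positions of [v] between [i] and [p] do not
    count. *)
Lemma rk_first_swap v w i j : (forall p q, rk v p q <= rk w p q) ->
    (forall m, m < i -> v m = w m) -> i < j -> v i < v j <= w i ->
    (forall m, i < m < j -> ~~ (v i < v m <= w i)) ->
  forall p q, rk (tperm i j * v) p q <= rk w p q.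
Proof.
move=> le_vw eq_lt ij /andP[vij vjw] nom p q; rewrite rk_tperm //.
have [/andP[/andP[ip pj] /andP[iq qj]]|_] := boolP (_ && _); last by rewrite addn0.
have S u : rk u p q = (rk u p (w i).+1 + \sum_(k < n) ((k < p) && (q <= u k <= w i)))%N.
  by rewrite /rk -big_split /=; apply: eq_bigr => k _; lia.
rewrite !S -addnA leq_add // (bigD1 i) //= [leqRHS](bigD1 i) //=.
rewrite ip leqnn (leq_trans qj vjw).
have -> : (q <= v i) = false by lia.
rewrite /= add0n addnC leq_add2l; apply: leq_sum => k ki.
have [lt_ki|] := ltnP k i; first by rewrite (eq_lt k).
rewrite leq_eqVlt val_eqE eq_sym (negbTE ki) /= => ik.
by have := nom k; rewrite ik /=; lia.
Qed.

Lemma ninv_le v : ninv v <= n * n.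
Proof.
rewrite /ninv -[X in _ <= X * _]card_ord -sum_nat_const; apply: leq_sum => a _.
rewrite -[X in _ <= X]muln1 -[X in _ <= X * _]card_ord -sum_nat_const.
by apply: leq_sum => b _; lia.
Qed.

(** Climb from [v] by first swaps, which preserve the rank inequalities; the bound [n * n] on
    inversions makes the climb stop. *)
Lemma rk_bruhat_le v w : (forall p q, rk v p q <= rk w p q) -> bruhat_le v w.
Proof.
have [N] := ubnP (n * n - ninv v); elim: N v => // N IH v lt_N le_vw.
have [->|/exists_first_diff[i [ne_i eq_lt]]] := eqVneq v w; first exact: connect0.
have [j [ij vij nom]] := exists_first_swap le_vw eq_lt ne_i.
have /andP[vij' _] := vij.
apply: bruhat_le_trans (bruhat_le_tperm ij vij') _; apply: IH.
  by have := ninv_tperm_lt ij vij'; have := ninv_le (tperm i j * v); lia.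
exact: rk_first_swap.
Qed.

(** * Covers and intervals of length two *)

Definition bruhat_cover v x := bruhat_le v x && (ninv x == (ninv v).+1).

Lemma bruhat_coverP v x :
  reflect (exists i j, [/\ i < j, v i < v j, ninv (tperm i j * v) = (ninv v).+1
                         & x = tperm i j * v])
          (bruhat_cover v x).
Proof.
apply: (iffP andP) => [[/connectP[[|u p] /=]]|[i [j [ij vij E ->]]]].
- by move=> _ -> /eqP; lia.
- move=> /andP[/bruhat_stepP[i [j [ij vij Eu]]] pth] Ex /eqP invx.
  have ux : bruhat_le u x by apply/connectP; exists p.
  have := ninv_tperm_lt ij vij; rewrite -Eu => lt.
  case/orP: (bruhat_le_ninv ux) => [|/eqP ux']; first lia.
  by exists i, j; rewrite -Eu ux'.
- by rewrite E eqxx; split=> //; apply: bruhat_le_tperm.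
Qed.

Lemma bruhat_cover_le v x : bruhat_cover v x -> bruhat_le v x.
Proof. by case/andP. Qed.

Lemma bruhat_cover_ninv v x : bruhat_cover v x -> ninv x = (ninv v).+1.
Proof. by case/andP=> _ /eqP. Qed.

Lemma first_swap_cover v w i j : bruhat_le v w ->
    (forall m, m < i -> v m = w m) -> i < j -> v i < v j <= w i ->
    (forall m, i < m < j -> ~~ (v i < v m <= w i)) ->
  bruhat_cover v (tperm i j * v) /\ bruhat_le (tperm i j * v) w.
Proof.
move=> /bruhat_le_rk le_vw eq_lt ij vij nom; have /andP[vij' vjw] := vij.
split; last by apply/rk_bruhat_le/rk_first_swap.
apply/bruhat_coverP; exists i, j; split=> //.
rewrite ninv_tperm // big1 ?muln0 ?addn0 ?addn1 // => m _.
by have := nom m; lia.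
Qed.

Lemma bruhat_le_first v w i : bruhat_le v w ->
  (forall m, m < i -> v m = w m) -> v i <= w i.
Proof. by move=> /bruhat_le_rk; apply: rk_le_first. Qed.

Lemma exists_first_cover v w i : bruhat_le v w ->
    (forall m, m < i -> v m = w m) -> v i != w i ->
  exists j, [/\ i < j, v i < v j <= w i,
    forall m, i < m < j -> ~~ (v i < v m <= w i),
    bruhat_cover v (tperm i j * v) & bruhat_le (tperm i j * v) w].
Proof.
move=> le_vw eq_lt ne_i.
have [j [ij vij nom]] := exists_first_swap (bruhat_le_rk le_vw) eq_lt ne_i.
by have [] := first_swap_cover le_vw eq_lt ij vij nom; exists j.
Qed.

(** [bruhat_le_first] squeezes [x m] between [v m] and [w m], by strong induction on the position
    [m]. *)
Lemma bruhat_between_first v x w i : bruhat_le v x -> bruhat_le x w ->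
  (forall m, m < i -> v m = w m) -> forall m, m < i -> x m = v m.
Proof.
move=> vx xw eq_lt m; have [N] := ubnP (m : nat); elim: N m => // N IH m lt_mN mi.
have eqx k : k < m -> x k = v k by move=> km; apply: IH; lia.
apply/val_inj/eqP; rewrite eqn_leq.
rewrite {1}(eq_lt m mi) (bruhat_le_first xw) => [/=|k km]; last first.
  by rewrite eqx // eq_lt //; lia.
by apply: bruhat_le_first vx _ => k km; rewrite eqx.
Qed.

(** The three factorizations of one 3-cycle; they settle all the overlapping cases of the two
    diamond lemmas. *)
Lemma tperm_braid i j k : i != j -> i != k -> j != k ->
  tperm i j * tperm j k = tperm j k * tperm i k /\
  tperm j k * tperm i k = tperm i k * tperm i j.
Proof.
move=> ij ik jk; split; rewrite conjgC tpermJ.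
  by rewrite tpermL tpermD // eq_sym.
by rewrite tpermR tpermD // 1?eq_sym // [tperm j i]tpermC.
Qed.

Lemma tpermC_disjoint i j k l : i != k -> i != l -> j != k -> j != l ->
  tperm i j * tperm k l = tperm k l * tperm i j.
Proof.
move=> ik il jk jl; apply/commgP/conjg_fixP.
by rewrite tpermJ !tpermD // eq_sym.
Qed.

Lemma middle_cover v y i j k l : i < j -> v i < v j -> k < l ->
    (tperm i j * v)%g k < (tperm i j * v)%g l ->
    y = tperm k l * (tperm i j * v) -> ninv y = (ninv v).+2 ->
  bruhat_cover v (tperm i j * v) /\ bruhat_cover (tperm i j * v) y.
Proof.
move=> ij vij kl vkl Ey Niny.
have := ninv_tperm_lt ij vij; have := ninv_tperm_lt kl vkl; rewrite -Ey Niny => lt1 lt2.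
have E : ninv (tperm i j * v) = (ninv v).+1 by lia.
split; first by apply/bruhat_coverP; exists i, j.
by apply/bruhat_coverP; exists k, l; rewrite -Ey Niny E.
Qed.

Lemma swapL v i j : (tperm i j * v) i = v j.
Proof. by rewrite permM tpermL. Qed.

Lemma swapR v i j : (tperm i j * v) j = v i.
Proof. by rewrite permM tpermR. Qed.

Lemma swapD v i j k : k != i -> k != j -> (tperm i j * v) k = v k.
Proof. by move=> ki kj; rewrite permM tpermD // eq_sym. Qed.

(** Made for [mem_atom_cone], where [i] is the first position moved. In the first two cases the
    direction of the second step is a root of an atom of [v], or the sum of [root i l] and such a
    root; the third case exhibits an atom exchanging [i] with a position beyond [l], against the
    maximal choice of [l]. *)
Lemma diamond_last v y i l k m : i < l -> v i < v l -> k < m -> i <= k ->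
    (tperm i l * v)%g k < (tperm i l * v)%g m ->
    y = tperm k m * (tperm i l * v) -> ninv y = (ninv v).+2 ->
  [\/ [/\ v k < v m, bruhat_cover v (tperm k m * v)
         & bruhat_le (tperm k m * v) y],
      [/\ k = i, l < m, v l < v m, bruhat_cover v (tperm l m * v)
         & bruhat_le (tperm l m * v) y]
    | [/\ l < m, v i < v m, bruhat_cover v (tperm i m * v)
         & bruhat_le (tperm i m * v) y]].
Proof.
move=> il vil km ik xkm Ey invy.
have mid (a b c d : 'I_n) : a < b -> v a < v b -> c < d ->
    y = tperm c d * (tperm a b * v) ->
    (tperm a b * v)%g c < (tperm a b * v)%g d ->
    bruhat_cover v (tperm a b * v) /\ bruhat_le (tperm a b * v) y.
  move=> ab vab cd E xcd; have [A B] := middle_cover ab vab cd xcd E invy.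
  by split=> //; apply: bruhat_cover_le.
have ne (a b : 'I_n) : a < b -> (a != b) * (b != a).
  by move=> ab; rewrite -!val_eqE /= neq_ltn ab neq_ltn ab orbT.
have [nil nli] := ne _ _ il; have [nkm nmk] := ne _ _ km.
have [Eki|nki] := eqVneq k i.
  subst k; have [Eml|nml] := eqVneq m l.
    by move: xkm; rewrite Eml swapL swapR; lia.
  move: xkm; rewrite swapL swapD // => vlm.
  have nlm : l != m by rewrite eq_sym.
  have [B1 B2] := tperm_braid nil nkm nlm.
  have Ey1 : y = tperm i l * (tperm l m * v).
    by rewrite Ey !mulgA -B2 -B1.
  have Ey2 : y = tperm l m * (tperm i m * v) by rewrite Ey1 !mulgA B1.
  case: (ltngtP m l) => [ml|lm|/val_inj/eqP]; last by rewrite (negbTE nml).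
    apply: Or31; have vim : v i < v m by lia.
    rewrite [tperm l m]tpermC in Ey2.
    have [|A B] := mid i m m l km vim ml Ey2; last by split.
    by rewrite swapR swapD // eq_sym.
  apply: Or32; have [|A B] := mid l m i l lm vlm il Ey1; last by split.
  by rewrite swapL swapD //; lia.
have ltik : i < k by rewrite ltn_neqAle ik andbT eq_sym.
have nmi : m != i by rewrite -val_eqE /=; lia.
have nim : i != m by rewrite eq_sym.
have nik : i != k by rewrite eq_sym.
have [Ekl|nkl] := eqVneq k l.
  subst k; move: xkm; rewrite swapR swapD // => vim.
  have [B1 B2] := tperm_braid nmk nmi nli.
  rewrite ![tperm m _]tpermC ![tperm l i]tpermC in B1 B2.
  have [vlm|] := ltnP (v l) (v m).
    have Ey' : y = tperm i m * (tperm l m * v) by rewrite Ey !mulgA B1 B2.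
    apply: Or31; have [|A B] := mid l m i m km vlm (ltn_trans il km) Ey'; last by split.
    by rewrite swapR swapD.
  rewrite leq_eqVlt => /orP[/eqP/val_inj/perm_inj/eqP|vml]; first by rewrite (negbTE nmk).
  have Ey' : y = tperm i l * (tperm i m * v) by rewrite Ey !mulgA B1.
  apply: Or33; have [|A B] := mid i m i l (ltn_trans il km) vim il Ey'; last by split.
  by rewrite swapL swapD.
have [Eml|nml] := eqVneq m l.
  subst m; move: xkm; rewrite swapR swapD // => vki.
  have [B1 B2] := tperm_braid nik nil nkm.
  apply: Or31; have vkl : v k < v l by lia.
  have Ey' : y = tperm i k * (tperm k l * v) by rewrite Ey !mulgA B1.
  have [|A B] := mid k l i k km vkl ltik Ey'; last by split.
  by rewrite swapL swapD.
move: xkm; rewrite !swapD // => vkm.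
have Ey' : y = tperm i l * (tperm k m * v).
  by rewrite Ey !mulgA tpermC_disjoint.
apply: Or31; have [|A B] := mid k m i l km vkm il Ey'; last by split.
by rewrite !swapD // eq_sym.
Qed.

(** Trades the middle of a chain of length two for one whose swap starts at the earlier position
    [i], or, if [i = k], exchanges [i] with an earlier position than [l]. The five shapes record the
    roots of both chains, so that [Dir_atom] can check that they span the same space. *)
Lemma diamond_first v y i j k l : k < l -> v k < v l -> i < j ->
    (tperm k l * v)%g i < (tperm k l * v)%g j ->
    y = tperm i j * (tperm k l * v) -> ninv y = (ninv v).+2 ->
    (i < k) || ((i == k) && (j < l)) ->
  exists j' r s : 'I_n, [/\ i < j', bruhat_cover v (tperm i j' * v),
     bruhat_cover (tperm i j' * v) y,
     [/\ v i < v j', r < s, (tperm i j' * v)%g r < (tperm i j' * v)%g s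
       & y = tperm r s * (tperm i j' * v)] &
     [\/ [/\ j' = j, r = k & s = l], [/\ j = k, j' = k, r = i & s = l],
         [/\ j = k, j' = l, r = k & s = l] | [\/ [/\ j = l, j' = k, r = k & s = l]
       | [/\ i = k, j' = j, r = j & s = l]]]].
Proof.
move=> kl vkl ij xij Ey invy cond.
have mid (a b c d : 'I_n) : a < b -> v a < v b -> c < d ->
    y = tperm c d * (tperm a b * v) ->
    (tperm a b * v)%g c < (tperm a b * v)%g d ->
    bruhat_cover v (tperm a b * v) /\ bruhat_cover (tperm a b * v) y.
  by move=> ab vab cd E xcd; apply: middle_cover E invy.
have ne (a b : 'I_n) : a < b -> (a != b) * (b != a).
  by move=> ab; rewrite -!val_eqE /= neq_ltn ab neq_ltn ab orbT.
have [nkl nlk] := ne _ _ kl; have [nij nji] := ne _ _ ij.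
case/orP: cond => [ik|/andP[/eqP Eik jl]]; last first.
  subst k; have [njl nlj] := ne _ _ jl.
  move: xij; rewrite swapL swapD // => vlj.
  have [B1 B2] := tperm_braid nji njl nkl.
  rewrite ![tperm j i]tpermC in B1 B2.
  have vij : v i < v j by lia.
  have Ey' : y = tperm j l * (tperm i j * v) by rewrite Ey !mulgA B1 B2.
  have H : (tperm i j * v)%g j < (tperm i j * v)%g l by rewrite swapR swapD.
  have [A B] := mid i j j l ij vij jl Ey' H.
  by exists j, j, l; split=> //; apply: Or44; right.
have [nik nki] := ne _ _ ik; have [nil nli] := ne _ _ (ltn_trans ik kl).
have [Ejk|njk] := eqVneq j k.
  subst j; move: xij; rewrite swapL swapD // => vil.
  have [B1 B2] := tperm_braid nij nil nkl.
  have [vik|] := ltnP (v i) (v k).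
    have Ey' : y = tperm i l * (tperm i k * v) by rewrite Ey !mulgA B1 B2.
    have H : (tperm i k * v)%g i < (tperm i k * v)%g l by rewrite swapL swapD.
    have il := ltn_trans ik kl; have [A B] := mid i k i l ij vik il Ey' H.
    by exists k, i, l; split=> //; apply: Or42.
  rewrite leq_eqVlt => /orP[/eqP/val_inj/perm_inj/eqP|vki]; first by rewrite (negbTE nki).
  have Ey' : y = tperm k l * (tperm i l * v) by rewrite Ey !mulgA B1.
  have H : (tperm i l * v)%g k < (tperm i l * v)%g l by rewrite swapR swapD.
  have il := ltn_trans ik kl; have [A B] := mid i l k l il vil kl Ey' H.
  by exists l, k, l; split=> //; apply: Or43.
have [Ejl|njl] := eqVneq j l.
  subst j; move: xij; rewrite swapR swapD // => vik.
  have [B1 B2] := tperm_braid nil nik nlk.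
  rewrite ![tperm l k]tpermC in B1 B2.
  have Ey' : y = tperm k l * (tperm i k * v) by rewrite Ey !mulgA B1.
  have H : (tperm i k * v)%g k < (tperm i k * v)%g l by rewrite swapR swapD //; lia.
  have [A B] := mid i k k l ik vik kl Ey' H.
  by exists k, k, l; split=> //; apply/Or44; left.
move: xij; rewrite !swapD // => vij.
have Ey' : y = tperm k l * (tperm i j * v).
  by rewrite Ey !mulgA tpermC_disjoint.
have H : (tperm i j * v)%g k < (tperm i j * v)%g l by rewrite !swapD // eq_sym.
have [A B] := mid i j k l ij vij kl Ey' H.
by exists j, k, l; split=> //; apply/Or41.
Qed.

End Inversions.

From mathcomp Require Import all_classical all_reals.
From mathcomp Require Import ring lra.

Import Order.TTheory GRing.Theory Num.Theory.
Local Open Scope ring_scope.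
Local Open Scope classical_set_scope.

(** * Faces and dimensions of polytopes *)

Section Hulls.
Variable R : realType.

Lemma dotrD n (c x y : 'rV[R]_n) : dotr c (x + y) = dotr c x + dotr c y.
Proof. by rewrite /dotr -big_split; apply: eq_bigr => i _; rewrite mxE mulrDr. Qed.

Lemma dotrZ n (c x : 'rV[R]_n) a : dotr c (a *: x) = a * dotr c x.
Proof. by rewrite /dotr mulr_sumr; apply: eq_bigr => i _; rewrite mxE mulrCA. Qed.

Lemma dotrB n (c x y : 'rV[R]_n) : dotr c (x - y) = dotr c x - dotr c y.
Proof. by rewrite dotrD -scaleN1r dotrZ mulN1r. Qed.

Lemma dotr0 n (c : 'rV[R]_n) : dotr c 0 = 0.
Proof. by rewrite -(scale0r 0) dotrZ mul0r. Qed.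

Lemma dotrC n (c x : 'rV[R]_n) : dotr c x = dotr x c.
Proof. by apply: eq_bigr => i _; rewrite mulrC. Qed.

Lemma dotr_sum n (c : 'rV[R]_n) I (r : seq I) (P : pred I) (F : I -> 'rV[R]_n) :
  dotr c (\sum_(i <- r | P i) F i) = \sum_(i <- r | P i) dotr c (F i).
Proof. exact: (big_morph (dotr c) (dotrD c) (dotr0 c)). Qed.

Definition spanf (V : vectType R) (I : finType) (h : I -> V) (T : {set I}) : {vspace V} :=
  (\sum_(i in T) <[h i]>)%VS.

Lemma spanfP (V : vectType R) (I : finType) (h : I -> V) (T : {set I}) x :
  reflect (exists a : I -> R, x = \sum_(i in T) a i *: h i) (x \in spanf h T).
Proof.
apply: (iffP memv_sumP) => [[f fh ->]|[a ->]]; last first.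
  by exists (fun i => a i *: h i) => // i _; rewrite memvZ ?memv_line.
have /choice[a ha] i : exists a, i \in T -> f i = a *: h i.
  have [iT|iT] := boolP (i \in T); last by exists 0.
  by have /vlineP[a ->] := fh i iT; exists a.
by exists a; apply: eq_bigr => i iT; rewrite ha.
Qed.

Lemma mem_spanf (V : vectType R) (I : finType) (h : I -> V) (T : {set I}) i :
  i \in T -> h i \in spanf h T.
Proof. by move=> iT; apply: subvP (memv_line (h i)); rewrite (sumv_sup i). Qed.

Lemma spanf_subv (V : vectType R) (I : finType) (h : I -> V) (T : {set I}) (U : {vspace V}) :
  (forall i, i \in T -> h i \in U) -> (spanf h T <= U)%VS.
Proof. by move=> hU; apply/subv_sumP => i iT; rewrite -memvE hU. Qed.

Lemma spanfS (V : vectType R) (I : finType) (h : I -> V) (S T : {set I}) :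
  S \subset T -> (spanf h S <= spanf h T)%VS.
Proof. by move=> /fintype.subsetP ST; apply: spanf_subv => i /ST; apply: mem_spanf. Qed.

Lemma dim_spanf_le (V : vectType R) (I : finType) (h : I -> V) (T : {set I}) :
  (\dim (spanf h T) <= #|T|)%N.
Proof.
apply: leq_trans (dimv_leq_sum _ _ _) _; rewrite -sum1_card.
by apply: leq_sum => i _; rewrite dim_vline; case: eqP.
Qed.

(** [f] is a projection with kernel [U], so some coordinate of [f x] is nonzero; [c] is that
    coordinate of [f], normalized at [x]. *)
Lemma separate n (U : {vspace 'rV[R]_n}) (x : 'rV[R]_n) : x \notin U ->
  exists c, (forall u, u \in U -> dotr c u = 0) /\ dotr c x = 1.
Proof.
move=> xU; pose f := (\1 - projv U)%VF.
have fE y : f y = y - projv U y by rewrite add_lfunE opp_lfunE id_lfunE.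
have [j fxj] : exists j, f x 0 j != 0.
  apply/existsP; apply: contraNT xU => /existsPn f0.
  suff /eqP : f x = 0 by rewrite fE subr_eq0 => /eqP->; apply: memv_proj.
  by apply/rowP => j; rewrite mxE; apply/eqP; have := f0 j; rewrite negbK.
pose c := \row_i (f (delta_mx 0 i) 0 j / f x 0 j).
have cE y : dotr c y = f y 0 j / f x 0 j.
  rewrite [in RHS](row_sum_delta y) linear_sum summxE mulr_suml.
  by apply: eq_bigr => i _; rewrite linearZ !mxE mulrC mulrA.
exists c; split=> [u uU|]; last by rewrite cE divff.
by rewrite cE fE (projv_id uU) subrr mxE mul0r.
Qed.

Definition hull n (I : finType) (p : I -> 'rV[R]_n) (T : {set I}) : set 'rV[R]_n :=
  conv_hull [set p i | i in [set` T]].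

(** Merging the repetitions of a generator adds its coefficients, so one coefficient per index
    suffices. *)
Lemma hullP n (I : finType) (p : I -> 'rV[R]_n) (T : {set I}) x :
  hull p T x <-> exists a : I -> R,
    [/\ forall i, 0 <= a i, \sum_(i in T) a i = 1 & x = \sum_(i in T) a i *: p i].
Proof.
split=> [[k [q [b [qT b0 b1 ->]]]]|[a [a0 a1 ->]]]; last first.
  exists #|T|, (fun j => p (enum_val j)), (fun j => a (enum_val j)).
  split=> //; last by rewrite big_enum_val.
    by move=> j; exists (enum_val j) => //; apply: enum_valP.
  by rewrite -a1 [RHS]big_enum_val.
have /choice[f Hf] j : exists i, i \in T /\ p i = q j.
  by have [i iT <-] := qT j; exists i.
have fT j : true -> f j \in T by move=> _; case: (Hf j).
exists (fun i => \sum_(j | f j == i) b j); split.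
- by move=> i; apply: sumr_ge0.
- by rewrite -b1 (partition_big f (mem T)).
- rewrite (partition_big f (mem T)) //; apply: eq_bigr => i iT.
  by rewrite scaler_suml; apply: eq_bigr => j /eqP <-; case: (Hf j) => _ ->.
Qed.

Lemma mem_hull n (I : finType) (p : I -> 'rV[R]_n) (T : {set I}) i :
  i \in T -> hull p T (p i).
Proof.
move=> iT; exists 1%N, (fun=> p i), (fun=> 1).
rewrite !big_ord1 scale1r; split=> // _; first by exists i.
Qed.

Lemma hull_le n (I : finType) (p : I -> 'rV[R]_n) (T : {set I}) c b :
  (forall i, i \in T -> dotr c (p i) <= b) -> forall x, hull p T x -> dotr c x <= b.
Proof.
move=> cb x /hullP[a [a0 a1 ->]]; rewrite dotr_sum -[leRHS]mul1r -a1 mulr_suml.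
by apply: ler_sum => i iT; rewrite dotrZ ler_wpM2l ?cb.
Qed.

Lemma hullS n (I : finType) (p : I -> 'rV[R]_n) (S T : {set I}) :
  S \subset T -> hull p S `<=` hull p T.
Proof.
move=> /fintype.subsetP ST x [k [q [b [qS b0 b1 ->]]]]; exists k, q, b; split=> // j.
by have [i iS <-] := qS j; exists i => //; apply: ST.
Qed.

(** The weighted slacks [a i * (b - dotr c (p i))] are nonnegative with sum zero, so generators off
    the hyperplane have weight zero. *)
Lemma face_hull n (I : finType) (p : I -> 'rV[R]_n) c b :
  (forall i, dotr c (p i) <= b) ->
  hull p [set: I]%SET `&` [set x | dotr c x = b] =
  hull p [set i | dotr c (p i) == b]%SET.
Proof.
move=> cb; apply/seteqP; split=> [x [/hullP[a [a0 a1 ->]]] /= cx|x xh]; last first.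
  split; first exact: hullS (finset.subsetT _) _ xh.
  case/hullP: xh => a [a0 a1 ->]; rewrite /= dotr_sum -[RHS]mul1r -a1 mulr_suml.
  by apply: eq_bigr => i; rewrite inE dotrZ => /eqP->.
have ai0 i : dotr c (p i) != b -> a i = 0.
  move=> ne; have /eqP : \sum_(i in [set: I]%SET) a i * (b - dotr c (p i)) = 0.
    under eq_bigr do rewrite mulrBr; rewrite sumrB -mulr_suml a1 mul1r -[X in X - _]cx.
    by apply/eqP; rewrite subr_eq0 dotr_sum; apply/eqP/eq_bigr => j _; rewrite dotrZ.
  rewrite psumr_eq0 => [/allP/(_ i)|j _]; last by rewrite mulr_ge0 ?subr_ge0.
  rewrite mem_index_enum inE mulf_eq0 subr_eq0 => /(_ isT)/orP[/eqP//|/eqP E].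
  by rewrite E eqxx in ne.
have S (V : nmodType) (F : I -> V) : (forall i, a i = 0 -> F i = 0) ->
    \sum_(i in [set: I]%SET) F i = \sum_(i in [set i | dotr c (p i) == b]%SET) F i.
  move=> F0; rewrite big_mkcond [RHS]big_mkcond; apply: eq_bigr => i _.
  by rewrite !inE; case: eqVneq => // /ai0/F0.
apply/hullP; exists a; split=> //; first by rewrite -a1 S.
by apply: S => i ->; rewrite scale0r.
Qed.

(** Recording a face by the generators on it turns the face poset into a poset of finite sets; the
    generators need not be vertices. *)
Definition faceset n (I : finType) (p : I -> 'rV[R]_n) (T : {set I}) : Prop :=
  exists c b, (forall i, dotr c (p i) <= b) /\ T = [set i | dotr c (p i) == b]%SET.

Lemma is_faceP n (I : finType) (p : I -> 'rV[R]_n) F :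
  is_face (hull p [set: I]%SET) F <-> exists T, faceset p T /\ F = hull p T.
Proof.
split=> [[c [b [cb ->]]]|[T [[c [b [cb ->]]] ->]]].
  have cbp i : dotr c (p i) <= b by apply/cb/mem_hull; rewrite inE.
  by rewrite face_hull //; exists [set i | dotr c (p i) == b]%SET; split=> //; exists c, b.
exists c, b; rewrite face_hull //; split=> //.
by apply: hull_le => i _.
Qed.

Lemma faceset_mem n (I : finType) (p : I -> 'rV[R]_n) T i :
  faceset p T -> hull p T (p i) <-> i \in T.
Proof.
move=> [c [b [cb ->]]]; split=> [|iT]; last exact: mem_hull.
by rewrite -face_hull // inE => -[_ /= ->].
Qed.

Lemma faceset_sub n (I : finType) (p : I -> 'rV[R]_n) S T :
  faceset p T -> hull p S `<=` hull p T <-> S \subset T.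
Proof.
move=> fT; split=> [ST|]; last exact: hullS.
by apply/fintype.subsetP => i iS; apply/(faceset_mem i fT)/ST/mem_hull.
Qed.

Lemma faceset_inj n (I : finType) (p : I -> 'rV[R]_n) S T :
  faceset p S -> faceset p T -> hull p S = hull p T -> S = T.
Proof.
move=> fS fT E; apply/eqP; rewrite finset.eqEsubset.
by apply/andP; split; [apply/(faceset_sub S fT)|apply/(faceset_sub T fS)]; rewrite E.
Qed.

Definition trace n (I : finType) (p : I -> 'rV[R]_n) (F : set 'rV[R]_n) : {set I} :=
  [set i | `[<F (p i)>]]%SET.

Lemma trace_hull n (I : finType) (p : I -> 'rV[R]_n) T :
  faceset p T -> trace p (hull p T) = T.
Proof.
by move=> fT; apply/setP => i; rewrite inE; apply/asboolP/idP => /(faceset_mem i fT).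
Qed.

Lemma is_face_trace n (I : finType) (p : I -> 'rV[R]_n) F :
  is_face (hull p [set: I]%SET) F -> faceset p (trace p F) /\ F = hull p (trace p F).
Proof. by move=> /is_faceP[T [fT ->]]; rewrite trace_hull. Qed.

Lemma is_face_hull n (I : finType) (p : I -> 'rV[R]_n) T :
  faceset p T -> is_face (hull p [set: I]%SET) (hull p T).
Proof. by move=> fT; apply/is_faceP; exists T. Qed.

Lemma trace_sub n (I : finType) (p : I -> 'rV[R]_n) F G :
  is_face (hull p [set: I]%SET) F -> is_face (hull p [set: I]%SET) G ->
  F `<=` G <-> trace p F \subset trace p G.
Proof.
by move=> /is_face_trace[fF EF] /is_face_trace[fG EG]; rewrite {1}EF {1}EG faceset_sub.
Qed.

Lemma comb_equiv_facesets n m (I : finType) (p : I -> 'rV[R]_n) (q : I -> 'rV[R]_m) :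
  (forall T, faceset p T <-> faceset q T) ->
  comb_equiv (hull p [set: I]%SET) (hull q [set: I]%SET).
Proof.
move=> pq; exists (fun F => hull q (trace p F)); split; last first.
  move=> F G fF fG; rewrite (trace_sub fF fG) faceset_sub //.
  by apply/pq; have [] := is_face_trace fG.
split=> [F fF|F G|G fG].
- by apply/is_face_hull/pq; have [] := is_face_trace fF.
- rewrite !inE => /is_face_trace[fF EF] /is_face_trace[fG EG] E.
  by rewrite EF EG; congr hull; apply: faceset_inj E; apply/pq.
- have [fT EG] := is_face_trace fG.
  have pT : faceset p (trace q G) by apply/pq.
  exists (hull p (trace q G)); first exact: is_face_hull.
  by rewrite trace_hull.
Qed.

(** The exposed faces of the cone generated by [h], as index sets. *)
Definition cface m (I : finType) (h : I -> 'rV[R]_m) (T : {set I}) : Prop :=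
  exists c, (forall i, 0 <= dotr c (h i)) /\ T = [set i | dotr c (h i) == 0]%SET.

Lemma dotr_spanf m (I : finType) (h : I -> 'rV[R]_m) (T : {set I}) c :
  (forall i, i \in T -> dotr c (h i) = 0) ->
  forall x, x \in spanf h T -> dotr c x = 0.
Proof.
move=> c0 x /spanfP[a ->]; rewrite dotr_sum big1 // => i iT.
by rewrite dotrZ c0 ?mulr0.
Qed.

(** The functional exposing [S] vanishes on the span of [S] but at no generator outside [S]. *)
Lemma cface_lt m (I : finType) (h : I -> 'rV[R]_m) (S T : {set I}) :
  cface h S -> S \proper T -> (\dim (spanf h S) < \dim (spanf h T))%N.
Proof.
move=> [c [_ ES]] /properP[ST [i iT iS]].
rewrite (ltn_leqif (dimv_leqif_sup (spanfS h ST))).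
apply: contra iS => /subvP/(_ _ (mem_spanf h iT)) hi.
rewrite ES inE; apply/eqP; apply: dotr_spanf hi => k.
by rewrite ES inE => /eqP.
Qed.

Lemma cface_trans m (I : finType) (h : I -> 'rV[R]_m) (T : {set I}) d :
  cface h T -> (forall i, i \in T -> 0 <= dotr d (h i)) ->
  cface h [set i in T | dotr d (h i) == 0]%SET.
Proof.
move=> [c [c0 ET]] d0.
(* A multiple of [c] that outweighs [d] at every generator off [T], where [c] is positive; the 1
   makes this strict. *)
pose M := 1 + \sum_(i in ~: T) `|dotr d (h i)| / dotr c (h i).
have cd x : dotr (M *: c + d) x = M * dotr c x + dotr d x.
  by rewrite dotrC dotrD dotrZ !(dotrC x).
have cT i : (i \in T) = (dotr c (h i) == 0) by rewrite ET inE.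
have pos i : i \notin T -> 0 < dotr (M *: c + d) (h i).
  move=> iT; have ci : 0 < dotr c (h i) by rewrite lt_def c0 -cT iT.
  have : `|dotr d (h i)| / dotr c (h i) < M.
    rewrite /M (bigD1 i) ?inE //= addrCA ltrDl ltr_wpDr ?ltr01 //.
    by apply: sumr_ge0 => k _; rewrite divr_ge0.
  rewrite ltr_pdivrMr // cd => lt; have := ler_norm (- dotr d (h i)).
  by rewrite normrN; lra.
exists (M *: c + d); split=> [i|].
  have [iT|iT] := boolP (i \in T); last exact: ltW (pos i iT).
  by rewrite cd; move: (iT); rewrite cT => /eqP->; rewrite mulr0 add0r d0.
apply/setP => i; rewrite !inE; have [iT|iT] := boolP (i \in T) => /=.
  by rewrite cd; move: (iT); rewrite cT => /eqP->; rewrite mulr0 add0r.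
by rewrite gt_eqF ?pos.
Qed.

(* Among the proper faces of [T] take one, [S], of largest dimension; if its
   codimension exceeded one, a supporting functional of [S] could be tilted
   about [S] until it meets another generator of [T]. *)
Lemma cface_facet m (I : finType) (h : I -> 'rV[R]_m) (T : {set I}) :
    cface h finset.set0 -> cface h T -> T != finset.set0 ->
  exists S : {set I}, [/\ S \proper T, cface h S & \dim (spanf h T) = (\dim (spanf h S)).+1].
Proof.
move=> f0 fT T0; pose P (S : {set I}) := (S \proper T) && `[<cface h S>].
have P0 : P finset.set0 by rewrite /P finset.proper0 T0; apply/asboolP.
case: (@arg_maxnP _ finset.set0 P (fun S : {set I} => \dim (spanf h S)) P0) => S /andP[pST /asboolP fS] Smax.
exists S; split=> //; apply/eqP; rewrite eqn_leq (cface_lt fS pST) andbT leqNgt.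
apply/negP => ltST; have /properP[ST [i0 i0T i0S]] := pST.
(* With [h i0] in [U], the functional [d] vanishes there too, so [i0] stays off the tilted face,
   which is therefore proper in [T]. *)
pose U := (spanf h S + <[h i0]>)%VS.
have [j jT jU] : exists2 j, j \in T & h j \notin U.
  apply/exists_inP; apply: contraLR ltST => /exists_inPn TU; rewrite -leqNgt.
  have TU' : (spanf h T <= U)%VS.
    by apply: spanf_subv => i /TU; rewrite negbK.
  apply: leq_trans (dimvS TU') _; apply: leq_trans (dimv_add_leqif _ _) _.
  by rewrite dim_vline -[leqRHS]addn1 leq_add2l leq_b1.
have [d [dU dj]] := separate jU; have [c [c0 ES]] := fS.
have dS i : i \in S -> dotr d (h i) = 0.
  by move=> iS; apply: dU; apply: subvP (mem_spanf h iS); apply: addvSl.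
have di0 : dotr d (h i0) = 0 by apply: dU; apply: subvP (memv_line _); apply: addvSr.
pose Q i := (i \in T) && (0 < dotr d (h i)).
have Qj : Q j by rewrite /Q jT dj ltr01.
case: (arg_minP (fun i => dotr c (h i) / dotr d (h i)) Qj) => i1 /andP[i1T d1] i1min.
(* The largest [t] for which [c - t *: d] stays nonnegative on [T]; it vanishes at [i1], which
   enlarges [S]. *)
pose t := dotr c (h i1) / dotr d (h i1).
have t0 : 0 <= t by rewrite divr_ge0 // ltW.
have eE x : dotr (c - t *: d) x = dotr c x - t * dotr d x.
  by rewrite dotrC dotrB dotrZ !(dotrC x).
have e0 i : i \in T -> 0 <= dotr (c - t *: d) (h i).
  move=> iT; rewrite eE subr_ge0; have [di|di] := ltP 0 (dotr d (h i)).
    by rewrite -ler_pdivlMr // i1min // /Q iT.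
  by apply: le_trans (c0 i); rewrite mulr_ge0_le0.
have fS' := cface_trans fT e0; set S' := [set _ in T | _]%SET in fS'.
have pS'T : S' \proper T.
  apply/properP; split; first by apply/fintype.subsetP => i; rewrite inE => /andP[].
  by exists i0; rewrite // inE i0T /= eE di0 mulr0 subr0; move: i0S; rewrite ES inE.
have pSS' : S \proper S'.
  apply/properP; split.
    apply/fintype.subsetP => i iS; rewrite inE (fintype.subsetP ST) //= eE dS // mulr0 subr0.
    by move: iS; rewrite ES inE.
  exists i1; first by rewrite inE i1T /= eE /t divfK ?subrr ?(gt_eqF d1).
  by apply: contraTN d1 => /dS->; rewrite ltxx.
have := cface_lt fS pSS'; rewrite ltnNge; case/negP; apply: Smax.
by rewrite /P pS'T; apply/asboolP.
Qed.

(* After homogenization the linear rank is the affine dimension plus one, so that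
   the empty face, of rank 0, needs no separate treatment. *)
Definition homog n (I : finType) (p : I -> 'rV[R]_n) (i : I) : 'rV[R]_(1 + n) :=
  row_mx 1%:M (p i).

Lemma dotr_row_mx m n (a x : 'rV[R]_m) (b y : 'rV[R]_n) :
  dotr (row_mx a b) (row_mx x y) = dotr a x + dotr b y.
Proof.
rewrite /dotr big_split_ord /=; congr (_ + _); apply: eq_bigr => i _.
  by rewrite !row_mxEl.
by rewrite !row_mxEr.
Qed.

Lemma faceset_cface n (I : finType) (p : I -> 'rV[R]_n) T :
  faceset p T <-> cface (homog p) T.
Proof.
split=> [[c [b [cb ->]]]|[c [c0 ->]]].
  have E i : dotr (row_mx b%:M (- c)) (homog p i) = b - dotr c (p i).
    rewrite dotr_row_mx {1}/dotr big_ord1 !mxE mulr1; congr (_ + _).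
    by rewrite dotrC -scaleN1r dotrZ mulN1r dotrC.
  exists (row_mx b%:M (- c)); split=> [i|]; first by rewrite E subr_ge0.
  by apply/setP => i; rewrite !inE E subr_eq0 eq_sym.
have E i : dotr c (homog p i) = lsubmx c 0 0 - dotr (- rsubmx c) (p i).
  rewrite -{1}[c]hsubmxK dotr_row_mx {1}/dotr big_ord1 !mxE mulr1.
  by congr (_ + _); rewrite -scaleN1r [in RHS]dotrC dotrZ mulN1r opprK dotrC.
exists (- rsubmx c), (lsubmx c 0 0); split=> [i|]; first by rewrite -subr_ge0 -E.
by apply/setP => i; rewrite !inE E subr_eq0 eq_sym.
Qed.

Lemma faceset0 n (I : finType) (p : I -> 'rV[R]_n) : faceset p finset.set0.
Proof.
exists 0, 1; split=> [i|]; first by rewrite dotrC dotr0 ler01.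
by apply/setP => i; rewrite !inE dotrC dotr0 eq_sym oner_eq0.
Qed.

Lemma row_mx1_sum n (I : finType) (P : pred I) (a : I -> R) (q : I -> 'rV[R]_n) :
  \sum_(i | P i) a i = 1 ->
  row_mx 1%:M (\sum_(i | P i) a i *: q i) =
    \sum_(i | P i) a i *: row_mx 1%:M (q i) :> 'rV[R]_(1 + n).
Proof.
move=> a1; apply/rowP => k; rewrite summxE -[k]splitK; case: (fintype.split k) => j /=.
  rewrite row_mxEl (ord1 j) mxE eqxx mulr1n -[LHS]a1; apply: eq_bigr => i _.
  by rewrite mxE row_mxEl mxE eqxx mulr1n mulr1.
by rewrite row_mxEr summxE; apply: eq_bigr => i _; rewrite mxE [in RHS]mxE row_mxEr.
Qed.

Lemma aff_hullE n (I : finType) (p : I -> 'rV[R]_n) (T : {set I}) :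
  aff_hull (hull p T) = [set x | row_mx 1%:M x \in spanf (homog p) T].
Proof.
apply/seteqP; split=> x /=.
  move=> [k [q [a [qT a1 ->]]]]; rewrite row_mx1_sum //.
  apply: memv_suml => j _; apply: memvZ; have /hullP[b [_ b1 ->]] := qT j.
  by rewrite row_mx1_sum //; apply/spanfP; exists b.
move=> /spanfP[a E].
have a1 : \sum_(i in T) a i = 1.
  have := congr1 (fun u : 'rV_(1 + n) => u 0 (lshift n 0)) E.
  rewrite row_mxEl mxE eqxx mulr1n summxE => ->; apply: eq_bigr => i _.
  by rewrite mxE row_mxEl mxE eqxx mulr1n mulr1.
exists #|T|, (fun j => p (enum_val j)), (fun j => a (enum_val j)); split.
- by move=> j; apply/mem_hull/enum_valP.
- by rewrite -a1 [RHS]big_enum_val.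
- rewrite -(big_enum_val (fun i => a i *: p i)).
  have := congr1 (@rsubmx _ _ 1 n) E; rewrite -row_mx1_sum //.
  by rewrite !row_mxKr.
Qed.

Lemma aff_hull_diff n (I : finType) (p : I -> 'rV[R]_n) (T : {set I}) i0 : i0 \in T ->
  aff_hull (hull p T) = [set p i0 + u | u in [set` spanf (fun i => p i - p i0) T]].
Proof.
move=> i0T; rewrite aff_hullE; apply/seteqP; split=> x /=.
  move=> /spanfP[a E].
  have a1 : \sum_(i in T) a i = 1.
    have := congr1 (fun u : 'rV_(1 + n) => u 0 (lshift n 0)) E.
    rewrite row_mxEl mxE eqxx mulr1n summxE => ->; apply: eq_bigr => i _.
    by rewrite mxE row_mxEl mxE eqxx mulr1n mulr1.
  have := congr1 (@rsubmx _ _ 1 n) E; rewrite -row_mx1_sum // !row_mxKr => ->.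
  exists (\sum_(i in T) a i *: (p i - p i0)); first by apply/spanfP; exists a.
  under eq_bigr do rewrite scalerBr.
  by rewrite sumrB -scaler_suml a1 scale1r addrC subrK.
move=> [u /spanfP[a ->] <-].
have jE (y : 'rV[R]_n) : row_mx 0 y = y *m row_mx 0 1%:M :> 'rV_(1 + n).
  by rewrite mul_mx_row mulmx0 mulmx1.
set y := (X in p i0 + X).
have -> : row_mx 1%:M (p i0 + y) = homog p i0 + row_mx 0 y by rewrite add_row_mx addr0.
rewrite memvD ?mem_spanf // jE mulmx_suml memv_suml // => i iT.
have -> : (a i *: (p i - p i0)) *m row_mx 0 1%:M = a i *: (homog p i - homog p i0).
  by rewrite -scalemxAl -jE opp_row_mx add_row_mx subrr.
by rewrite memvZ // memvB ?mem_spanf.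
Qed.

Lemma has_dim_hull n (I : finType) (p : I -> 'rV[R]_n) (T : {set I}) k :
  has_dim (hull p T) k <-> \dim (spanf (homog p) T) = k.+1.
Proof.
pose j : 'Hom('rV[R]_n, 'rV[R]_(1 + n)) := linfun (mulmxr (row_mx 0 1%:M)).
have jE u : j u = row_mx 0 u by rewrite lfunE /= mul_mx_row mulmx0 mulmx1.
(* The homogenized span is the line of [(1, x0)] plus the copy [j @: U]; the sum is direct because
   vectors of [j @: U] have first coordinate 0. *)
have core x0 (U : {vspace 'rV[R]_n}) :
    aff_hull (hull p T) = [set x0 + u | u in [set` U]] ->
    \dim (spanf (homog p) T) = (\dim U).+1.
  rewrite aff_hullE => affE.
  have memW x : row_mx 1%:M x \in spanf (homog p) T <-> (x - x0) \in U.
    have -> : (row_mx 1%:M x \in spanf (homog p) T : Prop) =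
              [set x | row_mx 1%:M x \in spanf (homog p) T] x by [].
    rewrite affE; split=> [[u /= uU <-]|xU]; first by rewrite addrC addKr.
    by exists (x - x0) => //; rewrite addrC subrK.
  have subjE x y : row_mx 1%:M x - row_mx 1%:M y = j (x - y).
    by rewrite jE opp_row_mx add_row_mx subrr.
  have x0W : row_mx 1%:M x0 \in spanf (homog p) T.
    by apply/memW; rewrite subrr mem0v.
  have -> : spanf (homog p) T = (<[row_mx 1%:M x0]> + j @: U)%VS.
    apply/eqP; rewrite eqEsubv; apply/andP; split.
      apply: spanf_subv => i iT; rewrite /homog -[row_mx _ (p i)](subrK (row_mx 1%:M x0)).
      rewrite addrC memv_add ?memv_line // subjE memv_img //.
      exact/memW/(mem_spanf (homog p) iT).
    apply/subvP => _ /memv_addP[_ /vlineP[a ->] [_ /memv_imgP[u uU ->] ->]].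
    rewrite memvD ?memvZ //.
    have -> : u = (x0 + u) - x0 by rewrite addrC addKr.
    by rewrite -subjE memvB //; apply/memW; rewrite addrC addKr.
  rewrite dimv_disjoint_sum.
    rewrite dim_vline limg_dim_eq; last first.
      apply/eqP; rewrite -subv0; apply/subvP => u; rewrite memv_cap memv_ker jE memv0.
      by move=> /andP[_ /eqP/(congr1 (@rsubmx _ _ 1 n))]; rewrite row_mxKr linear0 => ->.
    suff -> : row_mx 1%:M x0 != 0 :> 'rV[R]_(1 + n) by rewrite add1n.
    apply/negP => /eqP /(congr1 (@lsubmx _ _ 1 n)); rewrite row_mxKl linear0 => /rowP/(_ 0).
    by rewrite !mxE => /eqP; rewrite oner_eq0.
  apply/eqP; rewrite -subv0; apply/subvP => u; rewrite memv_cap memv0.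
  move=> /andP[/vlineP[a ->] /memv_imgP[y _]]; rewrite jE scale_row_mx.
  move=> /(congr1 (@lsubmx _ _ 1 n)); rewrite !row_mxKl => /rowP/(_ 0).
  by rewrite !mxE mulr1 => ->; rewrite !scale0r row_mx0.
split=> [[x0 [U [<- affE]]]|dimE]; first exact: core affE.
have [i0 i0T] : exists i, i \in T.
  apply/set0Pn; apply/negP => /eqP T0; move: dimE; rewrite T0 /spanf big_set0 dimv0; lia.
exists (p i0), (spanf (fun i => p i - p i0) T).
have affE := aff_hull_diff p i0T.
by split=> //; apply/eqP; rewrite -eqSS -(core _ _ affE) dimE.
Qed.

(** * The cube *)

Definition flip d (j : 'I_d) (u : {set 'I_d}) : {set 'I_d} :=
  [set k | (k \in u) (+) (k == j)]%SET.

Definition subcube d (u J : {set 'I_d}) : {set {set 'I_d}} :=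
  [set S : {set 'I_d} | [forall j in J, (j \in S) == (j \in u)]]%SET.

Lemma subcubeP d (u J S : {set 'I_d}) :
  reflect (forall j, j \in J -> (j \in S) = (j \in u)) (S \in subcube u J).
Proof.
rewrite inE; apply: (iffP forall_inP) => H j jJ; first exact/eqP/H.
by rewrite H.
Qed.

Lemma subcube_refl d (u J : {set 'I_d}) : u \in subcube u J.
Proof. exact/subcubeP. Qed.

Lemma subcube_base d (u u' J : {set 'I_d}) :
  u' \in subcube u J -> subcube u J = subcube u' J.
Proof.
move=> /subcubeP Ju; apply/setP => S.
by apply/subcubeP/subcubeP => H j jJ; rewrite H // Ju.
Qed.

Lemma flip_subcube d (u J : {set 'I_d}) j : (flip j u \in subcube u J) = (j \notin J).
Proof.
apply/subcubeP/idP => [H|jJ k kJ].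
  by apply/negP => /H; rewrite inE eqxx addbT; case: (_ \in _).
by rewrite inE (_ : k == j = false) ?addbF //; apply: contraNF jJ => /eqP <-.
Qed.

Lemma subcube_sub d (u J K : {set 'I_d}) :
  (subcube u J \subset subcube u K) = (K \subset J).
Proof.
apply/fintype.subsetP/fintype.subsetP => [H j jK|KJ S /subcubeP H]; last first.
  by apply/subcubeP => j /KJ/H.
by apply: contraTT jK; rewrite -!(flip_subcube u) => /H.
Qed.

(** Used for both the cube and the interval polytopes. At a base point [u] the facet functionals are
    dual, up to positive factors, to the differences towards the [d] neighbours [flip j u], which
    therefore form a basis of [U]. In it every [p S - p u] has nonnegative coordinates, zero exactly
    where [S] and [u] agree, so a functional maximal at [u] exposes a face determined by the
    neighbours on it. *)
Lemma cubelike_facesets n d (p : {set 'I_d} -> 'rV[R]_n) (U : {vspace 'rV[R]_n}) :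
    (\dim U <= d)%N -> (forall S T, p S - p T \in U) ->
    (forall j (b : bool), exists c a, forall S,
       a <= dotr c (p S) /\ (dotr c (p S) == a) = ((j \in S) == b)) ->
  forall T, faceset p T <-> T = finset.set0 \/ exists u J, T = subcube u J.
Proof.
move=> dimU pU facets T.
have /choice[c' Hc'] j : exists f : bool -> 'rV[R]_n * R, forall b S,
    (f b).2 <= dotr (f b).1 (p S) /\
    (dotr (f b).1 (p S) == (f b).2) = ((j \in S) == b).
  have [c [a H]] := facets j true; have [c1 [a1 H1]] := facets j false.
  by exists (fun b => if b then (c, a) else (c1, a1)) => -[].
pose c j b := (c' j b).1; pose a j b := (c' j b).2.
have cge j b S : a j b <= dotr (c j b) (p S) by case: (Hc' j b S).
have ceq j b S : (dotr (c j b) (p S) == a j b) = ((j \in S) == b).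
  by case: (Hc' j b S).
have coords u S : exists l : 'I_d -> R,
    [/\ p S - p u = \sum_j l j *: (p (flip j u) - p u),
        forall j, 0 <= l j & forall j, (l j == 0) = ((j \in S) == (j \in u))].
  pose X := [tuple p (flip j u) - p u | j < d].
  have XE (j : 'I_d) : X`_j = p (flip j u) - p u by rewrite -tnth_nth tnth_mktuple.
  have cu k : dotr (c k (k \in u)) (p u) = a k (k \in u) by apply/eqP; rewrite ceq.
  have cX k (j : 'I_d) : dotr (c k (k \in u)) X`_j =
      if k == j then dotr (c k (k \in u)) (p (flip k u)) - a k (k \in u) else 0.
    rewrite XE dotrB cu; case: (eqVneq k j) => [->//|kj].
    by apply/eqP; rewrite subr_eq0 ceq inE (negbTE kj) addbF.
  have cpos k : 0 < dotr (c k (k \in u)) (p (flip k u)) - a k (k \in u).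
    by rewrite subr_gt0 lt_def cge andbT ceq inE eqxx addbT; case: (_ \in _).
  have csum k (l : 'I_d -> R) : dotr (c k (k \in u)) (\sum_j l j *: X`_j) =
      l k * (dotr (c k (k \in u)) (p (flip k u)) - a k (k \in u)).
    rewrite dotr_sum (bigD1 k) //= dotrZ cX eqxx big1 ?addr0 // => j jk.
    by rewrite dotrZ cX eq_sym (negbTE jk) mulr0.
  have freeX : free X.
    apply/freeP => l l0 k; have := csum k l; rewrite l0 dotr0 => /esym/eqP.
    by rewrite mulf_eq0 (gt_eqF (cpos k)) orbF => /eqP.
  have spanX : <<X>>%VS = U.
    apply/eqP; rewrite eqEdim; apply/andP; split.
      by apply/span_subvP => x /tnthP[j ->]; rewrite tnth_mktuple.
    by move: freeX; rewrite /free size_tuple => /eqP->.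
  have SX : p S - p u \in <<X>>%VS by rewrite spanX.
  have E := coord_span SX; exists (fun j => coord X j (p S - p u)).
  have lE k : coord X k (p S - p u) * (dotr (c k (k \in u)) (p (flip k u)) - a k (k \in u))
     = dotr (c k (k \in u)) (p S) - a k (k \in u).
    by rewrite -(csum k (fun j => coord X j (p S - p u))) -E dotrB cu.
  split=> [|k|k]; first by rewrite {1}E; apply: eq_bigr => j _; rewrite XE.
    by rewrite -(pmulr_lge0 _ (cpos k)) lE subr_ge0.
  by rewrite -ceq -[RHS]subr_eq0 -lE mulf_eq0 (gt_eqF (cpos k)) orbF.
split=> [[e [b [eb ET]]]|[->|[u [J ->]]]]; last first.
- exists (- \sum_(j in J) c j (j \in u)), (- \sum_(j in J) a j (j \in u)).
  have E S : dotr (- \sum_(j in J) c j (j \in u)) (p S) =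
             - \sum_(j in J) dotr (c j (j \in u)) (p S).
    rewrite -scaleN1r dotrC dotrZ mulN1r dotr_sum; congr (- _).
    by apply: eq_bigr => j _; rewrite dotrC.
  split=> [S|]; first by rewrite E lerN2 ler_sum.
  apply/setP => S; rewrite [in RHS]inE E eqr_opp -subr_eq0 -sumrB psumr_eq0 => [|j _].
    apply/subcubeP/allP => [H j _|H j jJ].
      by apply/implyP => /H jS; rewrite subr_eq0 ceq jS eqxx.
    have := H j; rewrite mem_index_enum jJ subr_eq0 ceq => /(_ isT)/eqP ->.
    by [].
  by rewrite subr_ge0.
- exact: faceset0.
have [->|/set0Pn[u uT]] := eqVneq T finset.set0; [by left|right].
have eu : dotr e (p u) = b by move: uT; rewrite ET inE => /eqP.
exists u, [set j | dotr e (p (flip j u)) != b]%SET; apply/setP => S.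
have [l [SE l0 leq]] := coords u S.
(* From [u] to [S] the functional loses [l j] times the slack of the neighbour [flip j u], summed
   over [j]. *)
have -> : (S \in T) = (\sum_j l j * (b - dotr e (p (flip j u))) == 0).
  rewrite ET inE -[in LHS](subrK (p u) (p S)) dotrD eu -subr_eq0 addrK SE dotr_sum.
  rewrite -oppr_eq0 -sumrN; congr (_ == 0); apply: eq_bigr => j _.
  by rewrite dotrZ dotrB eu -mulrN opprB.
rewrite psumr_eq0 => [|j _]; last by rewrite mulr_ge0 ?subr_ge0.
apply/allP/subcubeP => H j => [|_].
  rewrite inE => jb; have := H j (mem_index_enum _).
  by rewrite /= mulf_eq0 subr_eq0 [b == _]eq_sym (negbTE jb) orbF leq => /eqP.
rewrite /= mulf_eq0 subr_eq0 leq [b == _]eq_sym.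
by have := H j; rewrite inE; case: eqP => [_ _|_ /(_ isT)->]; rewrite ?orbT ?eqxx.
Qed.

Definition cube_vertex d (S : {set 'I_d}) : 'rV[R]_d := \row_i (i \in S)%:R.

Lemma dotr_delta n (i : 'I_n) (x : 'rV[R]_n) : dotr (delta_mx 0 i) x = x 0 i.
Proof.
rewrite /dotr (bigD1 i) //= mxE !eqxx mul1r big1 ?addr0 // => j /negbTE ji.
by rewrite mxE ji andbF mul0r.
Qed.

Lemma cube_facesets d (T : {set {set 'I_d}}) :
  faceset (@cube_vertex d) T <-> T = finset.set0 \/ exists u J, T = subcube u J.
Proof.
apply: (@cubelike_facesets d d _ fullv) => [|S S'|j []].
- by rewrite dimvf dim_matrix mul1r.
- exact: memvf.
- exists (- delta_mx 0 j), (- 1) => S.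
  rewrite dotrC -scaleN1r dotrZ mulN1r dotrC dotr_delta mxE lerN2 eqr_opp.
  by case: (j \in S); rewrite ?ler01 ?lexx ?eqxx // eq_sym oner_eq0.
- exists (delta_mx 0 j), 0 => S; rewrite dotr_delta mxE.
  by case: (j \in S); rewrite ?ler01 ?lexx ?eqxx // oner_eq0.
Qed.

Lemma cube_hull d : cube R d = hull (@cube_vertex d) [set: {set 'I_d}]%SET.
Proof.
apply/seteqP; split=> x; last first.
  move=> /hullP[a [a0 a1 ->]] i; rewrite summxE -a1.
  apply/andP; split; first by apply: sumr_ge0 => S _; rewrite !mxE mulr_ge0.
  by apply: ler_sum => S _; rewrite !mxE ler_piMr // lern1 leq_b1.
move=> cx; apply/hullP.
have prodE (F G : 'I_d -> R) : \sum_(S in [set: {set 'I_d}]%SET)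
     \prod_i (if i \in S then F i else G i) = \prod_i (F i + G i).
  by rewrite bigA_distr; apply: eq_bigl => S; rewrite !inE.
(* The law of a random set containing each [i] independently with probability [x 0 i]; its mean is
   [x]. *)
exists (fun S : {set 'I_d} => \prod_i (if i \in S then x 0 i else 1 - x 0 i)); split.
- move=> S; apply: prodr_ge0 => i _; have /andP[? ?] := cx i.
  by case: ifP; rewrite ?subr_ge0.
- by rewrite prodE big1 // => i _; rewrite addrC subrK.
apply/rowP => k; rewrite summxE.
(* Replacing the second summand at [k] by 0 discards the sets that avoid [k]. *)
transitivity (\prod_i (x 0 i + (if i == k then 0 else 1 - x 0 i))).
  by rewrite (bigD1 k) //= eqxx addr0 big1 ?mulr1 // => i /negbTE->; rewrite addrC subrK.
rewrite -prodE; apply: eq_bigr => S _; rewrite !mxE.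
have [kS|kS] := boolP (k \in S); rewrite ?mulr1 ?mulr0.
  by apply: eq_bigr => i _; case: eqP => // ->; rewrite kS.
by rewrite (bigD1 k) //= (negbTE kS) eqxx mul0r.
Qed.

End Hulls.

(** * Rank functions on face posets *)

Section SubcubeRank.
Variable R : realType.

(** Descending rank by rank on the left forces strict descents on the right. A relation [Q], instead
    of a function, lets the same statement serve for an isomorphism and its inverse. *)
Lemma graded_le (A B : Type) (Q : A -> B -> Prop) (X : A -> Prop) (Y : B -> Prop)
    (ltA : A -> A -> Prop) (ltB : B -> B -> Prop) (r : A -> nat) (s : B -> nat) :
    (forall a b, Q a b -> X a /\ Y b) ->
    (forall a b a', Q a b -> X a' -> ltA a' a -> exists2 b', Q a' b' & ltB b' b) ->
    (forall a, X a -> (0 < r a)%N -> exists a', [/\ X a', ltA a' a & r a = (r a').+1]) ->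
    (forall b b', Y b -> Y b' -> ltB b' b -> (s b' < s b)%N) ->
  forall a b, Q a b -> (r a <= s b)%N.
Proof.
move=> QXY Qlt pred mono a b; have [N] := ubnP (r a).
elim: N a b => // N IH a b lt_aN Qab; have [Xa Yb] := QXY _ _ Qab.
have [->//|ra0] := posnP (r a); have [a' [Xa' lt_a E]] := pred a Xa ra0.
have [b' Qa'b' lt_b] := Qlt _ _ _ Qab Xa' lt_a.
have [_ Yb'] := QXY _ _ Qa'b'.
rewrite E; apply: leq_ltn_trans (IH _ _ _ Qa'b') (mono _ _ Yb Yb' lt_b).
by rewrite -ltnS -E.
Qed.

(** The free coordinates are read off the set itself, because the pair [(u, J)] presenting a subcube
    is not unique. *)
Definition moving d (T : {set {set 'I_d}}) : {set 'I_d} :=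
  [set j | [exists S in T, exists S' in T, (j \in S) != (j \in S')]]%SET.

Lemma moving_subcube d (u J : {set 'I_d}) : moving (subcube u J) = (~: J)%SET.
Proof.
apply/setP => j; rewrite !inE; apply/exists_inP/idP => [[S /subcubeP H]|jJ].
  move=> /exists_inP[S' /subcubeP H'] ne; apply: contra ne => jJ.
  by rewrite H // H'.
exists u; first exact: subcube_refl.
apply/exists_inP; exists (flip j u); first by rewrite flip_subcube.
by rewrite inE eqxx addbT; case: (_ \in _).
Qed.

(* Dimension plus one, with rank 0 for the empty face, as for [homog]. *)
Definition crank d (T : {set {set 'I_d}}) : nat :=
  if T == finset.set0 then 0%N else #|moving T|.+1.

Lemma crank_subcube d (u J : {set 'I_d}) : crank (subcube u J) = (#|~: J|.+1)%SET.
Proof.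
rewrite /crank moving_subcube; case: eqP => // T0.
by have := subcube_refl u J; rewrite T0 inE.
Qed.

Lemma crank_facet d (T : {set {set 'I_d}}) :
    faceset (@cube_vertex R d) T -> (0 < crank T)%N ->
  exists S : {set {set 'I_d}}, [/\ faceset (@cube_vertex R d) S, S \proper T & crank T = (crank S).+1].
Proof.
move=> /cube_facesets[->|[u [J ->]]]; first by rewrite /crank eqxx.
move=> _; have [JT|/existsP[j jJ]] : J = [set: 'I_d]%SET \/ [exists j, j \notin J].
- have [/forallP H|] := boolP [forall j, j \in J]; last by rewrite negb_forall; right.
  by left; apply/setP => j; rewrite H inE.
- exists finset.set0; split; first exact: faceset0.
    rewrite finset.proper0; apply/set0Pn; exists u; exact: subcube_refl.
  by rewrite crank_subcube JT finset.setCT cards0 /crank eqxx.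
- exists (subcube u (j |: J)%SET); split.
  + by apply/cube_facesets; right; exists u, (j |: J)%SET.
  + rewrite fintype.properE !subcube_sub finset.subsetUr /=.
    by apply: contra jJ => /fintype.subsetP/(_ j); apply; rewrite !inE eqxx.
  + rewrite !crank_subcube; congr _.+1.
    rewrite (cardsD1 j (~: J)%SET) inE jJ add1n; congr _.+1; apply: eq_card => k.
    by rewrite !inE negb_or.
Qed.

Lemma crank_lt d (S T : {set {set 'I_d}}) :
  faceset (@cube_vertex R d) S -> faceset (@cube_vertex R d) T -> S \proper T ->
  (crank S < crank T)%N.
Proof.
move=> fS fT /[dup] /properP[ST [u0 u0T u0S]].
have cT : (0 < crank T)%N.
  by rewrite /crank; case: eqP u0T => // ->; rewrite inE.
case/cube_facesets: fS (ST) => [->|[u [J ->]]]; first by rewrite /crank eqxx.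
move=> /fintype.subsetP/(_ _ (subcube_refl u J)).
case/cube_facesets: fT => [->|[u' [K ->]]]; first by rewrite inE.
move=> /subcube_base->; rewrite fintype.properE !subcube_sub => /andP[KJ JK].
rewrite !crank_subcube ltnS proper_card // fintype.properE finset.setCS KJ.
by rewrite finset.setCS.
Qed.

Lemma homog_rank_facet n (I : finType) (p : I -> 'rV[R]_n) T :
    faceset p T -> (0 < \dim (spanf (homog p) T))%N ->
  exists S : {set I}, [/\ faceset p S, S \proper T
    & \dim (spanf (homog p) T) = (\dim (spanf (homog p) S)).+1].
Proof.
move=> /faceset_cface fT r0.
have T0 : T != finset.set0.
  by apply: contraTneq r0 => ->; rewrite /spanf big_set0 dimv0.
have [|S [pST fS E]] := cface_facet _ fT T0; first exact/faceset_cface/faceset0.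
by exists S; split=> //; apply/faceset_cface.
Qed.

Lemma is_face_ltP n (I : finType) (p : I -> 'rV[R]_n) F G :
  is_face (hull p [set: I]%SET) F -> is_face (hull p [set: I]%SET) G ->
  (trace p F \proper trace p G) <-> (F `<=` G /\ F <> G).
Proof.
move=> fF fG; rewrite fintype.properE; split=> [/andP[/(trace_sub fF fG) FG]|[FG nFG]].
  by move=> nGF; split=> // E; move: nGF; rewrite E fintype.subxx.
apply/andP; split; first exact/(trace_sub fF fG).
by apply/negP => /(trace_sub fG fF) GF; apply: nFG; apply/seteqP.
Qed.

End SubcubeRank.

(** * Simplicity of polytopes combinatorially equivalent to a cube *)

Section CombinatorialCube.
Variables (R : realType) (n : nat) (I : finType) (p : I -> 'rV[R]_n) (d : nat).
Local Notation P := (hull p [set: I]%SET).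
Local Notation q := (@cube_vertex R d).
Local Notation C := (hull q [set: {set 'I_d}]%SET).
Local Notation rank F := (\dim (spanf (homog p) (trace p F))).
Variable phi : set 'rV[R]_n -> set 'rV[R]_d.
Hypothesis phi_bij : set_bij [set F | is_face P F] [set G | is_face C G] phi.
Hypothesis phi_sub : forall F G, is_face P F -> is_face P G ->
  (F `<=` G <-> phi F `<=` phi G).

Let phi_face F : is_face P F -> is_face C (phi F).
Proof. by case: phi_bij => H _ _ fF; apply: (H F). Qed.

Let phi_surj G : is_face C G -> exists2 F, is_face P F & phi F = G.
Proof. by case: phi_bij => _ _ H /H[F fF <-]; exists F. Qed.

Let phi_inj F G : is_face P F -> is_face P G -> phi F = phi G -> F = G.
Proof. by case: phi_bij => _ H _ fF fG; apply: H; rewrite inE. Qed.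

Let phi_lt F G : is_face P F -> is_face P G ->
  (F `<=` G /\ F <> G) <-> (phi F `<=` phi G /\ phi F <> phi G).
Proof.
move=> fF fG; rewrite (phi_sub fF fG); split=> -[FG ne]; split=> // E; apply: ne.
  exact: phi_inj.
by rewrite E.
Qed.

(** Both ranks increase strictly along inclusions, and each face of positive rank contains one of
    rank exactly one less, so [graded_le] applies in both directions. *)
Lemma rank_phi F : is_face P F -> rank F = crank (trace q (phi F)).
Proof.
pose lt m (F' F'' : set 'rV[R]_m) := F' `<=` F'' /\ F' <> F''.
move=> fF; apply/eqP; rewrite eqn_leq; apply/andP; split.
  apply: (@graded_le _ _ (fun F G => is_face P F /\ G = phi F) (is_face P) (is_face C)
    (@lt n) (@lt d) (fun F => rank F) (fun G => crank (trace q G))); last by split.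
  - by move=> F' G' [fF' ->]; split=> //; apply: phi_face.
  - move=> F' G' F'' [fF' ->] fF'' /(phi_lt fF'' fF') lt'.
    by exists (phi F'').
  - move=> F' fF' r0; have [fT EF'] := is_face_trace fF'.
    have [S [fS pST E]] := homog_rank_facet fT r0.
    exists (hull p S); have fS' := is_face_hull fS; split=> //.
      by apply/(is_face_ltP fS' fF'); rewrite trace_hull.
    by rewrite E trace_hull.
  - move=> G G' fG fG' /(is_face_ltP fG' fG); apply: (@crank_lt R).
      by have [] := is_face_trace fG'.
    by have [] := is_face_trace fG.
apply: (@graded_le _ _ (fun G F => is_face P F /\ G = phi F) (is_face C) (is_face P)
    (@lt d) (@lt n) (fun G => crank (trace q G)) (fun F => rank F)); last by split.
- by move=> G' F' [fF' ->]; split=> //; apply: phi_face.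
- move=> G' F' G'' [fF' ->] /phi_surj[F'' fF'' <-] /(phi_lt fF'' fF') lt'.
  by exists F''.
- move=> G fG r0; have [fT EG] := is_face_trace fG.
  have [S [fS pST E]] := crank_facet fT r0.
  exists (hull q S); have fS' := is_face_hull fS; split=> //.
    by apply/(is_face_ltP fS' fG); rewrite trace_hull.
  by rewrite E trace_hull.
- move=> F1 F2 fF1 fF2 /(is_face_ltP fF2 fF1); apply: cface_lt.
  by apply/faceset_cface; have [] := is_face_trace fF2.
Qed.

Lemma has_dim_face F k : is_face P F -> has_dim F k <-> rank F = k.+1.
Proof. by move=> fF; have [_ {1}->] := is_face_trace fF; rewrite has_dim_hull. Qed.

Lemma rank_point x : is_face P [set x] -> rank [set x] = 1%N.
Proof.
move=> /[dup] fx /is_face_trace[_ xE]; apply/eqP; rewrite eqn_leq; apply/andP; split.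
  have sub : (spanf (homog p) (trace p [set x]) <= <[row_mx 1%:M x]>)%VS.
    apply: spanf_subv => i; rewrite inE => /asboolP /= pix.
    by rewrite /homog pix memv_line.
  by apply: leq_trans (dimvS sub) _; rewrite dim_vline leq_b1.
have [T0|T0] := eqVneq (trace p [set x]) finset.set0.
  have : hull p (trace p [set x]) x by rewrite -xE.
  rewrite T0 => /hullP[a [_ + _]]; rewrite big_set0 => /eqP.
  by rewrite eq_sym oner_eq0.
have f0 : cface (homog p) finset.set0 by apply/faceset_cface/faceset0.
by apply: leq_ltn_trans (cface_lt f0 _); rewrite ?finset.proper0.
Qed.

Lemma is_simple_of_cube : is_simple P.
Proof.
have fP : is_face P P.
  apply: is_face_hull; exists 0, 0; split=> [i|]; first by rewrite dotrC dotr0.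
  by apply/setP => i; rewrite !inE dotrC dotr0 eqxx.
have fC : is_face C C.
  apply: is_face_hull; exists 0, 0; split=> [i|]; first by rewrite dotrC dotr0.
  by apply/setP => i; rewrite !inE dotrC dotr0 eqxx.
have faceP F : is_face P F -> F `<=` P by move=> [c [b [_ ->]]] x [].
have faceC F : is_face C F -> F `<=` C by move=> [c [b [_ ->]]] x [].
have phiP : phi P = C.
  apply/seteqP; split; first exact/faceC/phi_face.
  by have [F fF <-] := phi_surj fC; apply/phi_sub => //; apply: faceP.
have fullE : [set: {set 'I_d}]%SET = subcube finset.set0 finset.set0.
  by apply/setP => S; rewrite inE; apply/esym/subcubeP => j; rewrite inE.
have fsub u J : faceset q (subcube u J) by apply/cube_facesets; right; exists u, J.
exists d; split.
  apply/has_dim_face => //; rewrite rank_phi // phiP trace_hull; last by rewrite fullE.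
  by rewrite fullE crank_subcube finset.setC0 cardsT card_ord.
move=> x fx; have fphix := phi_face fx.
have /esym := rank_phi fx; rewrite rank_point //.
have [/cube_facesets[->|[u [J EJ]]] xE] := is_face_trace fphix; first by rewrite /crank eqxx.
rewrite EJ crank_subcube => -[/eqP]; rewrite cards_eq0 => /eqP/(congr1 (@finset.setC _)).
rewrite finset.setCK finset.setC0 => JT; rewrite {}JT in EJ.
(* The vertex corresponds to a subcube with every coordinate frozen at [u]; freeing the single
   coordinate [j] gives the edges of the cube through it. *)
pose G j := hull q (subcube u (~: [set j])%SET).
have fG j : is_face C (G j) by apply/is_face_hull/fsub.
have /choice[e He] j : exists F, is_face P F /\ phi F = G j.
  by have [F fF E] := phi_surj (fG j); exists F.
have edgeE F : is_face P F ->
    (is_edge P F /\ F x) <-> exists j, phi F = G j.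
  move=> fF; have Fx : F x <-> [set x] `<=` F by split=> [Fx _ ->//|]; apply.
  rewrite /is_edge has_dim_face // rank_phi // Fx (phi_sub fx fF).
  rewrite (trace_sub fphix (phi_face fF)) EJ.
  have [/cube_facesets[T0|[u' [K EK]]] FE] := is_face_trace (phi_face fF).
    rewrite T0 /crank eqxx; split=> [[[]]//|[j E]].
    by move: T0; rewrite E trace_hull // => /setP/(_ u); rewrite subcube_refl inE.
  rewrite EK crank_subcube; split=> [[[_ [/eqP/cards1P[j Kj]]] /fintype.subsetP uK]|[j E]].
    exists j; rewrite FE EK /G; congr hull.
    have KE : K = (~: [set j])%SET by rewrite -Kj finset.setCK.
    by rewrite -KE; apply: subcube_base; apply: uK; apply: subcube_refl.
  move: EK; rewrite E trace_hull // => EK.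
  have uK : u \in subcube u' K by rewrite -EK subcube_refl.
  move: (EK); rewrite (subcube_base uK) => /eqP; rewrite finset.eqEsubset !subcube_sub => KE.
  have {}KE : K = (~: [set j])%SET by apply/eqP; rewrite finset.eqEsubset.
  rewrite KE finset.setCK cards1 -KE; split; first by split.
  exact: finset.subsetT.
have -> : [set E | is_edge P E /\ E x] = [set e j | j in [set: 'I_d]].
  apply/seteqP; split=> [F /= FE|F [j _ <-] /=].
    have fF : is_face P F by case: FE => -[].
    have /(edgeE F fF)[j Ej] := FE; have [fe Ee] := He j.
    by exists j => //; apply: phi_inj => //; rewrite Ee.
  by have [fe Ee] := He j; apply/(edgeE _ fe); exists j.
have injG j k : G j = G k -> j = k.
  move=> /(faceset_inj (fsub _ _) (fsub _ _)) /eqP; rewrite finset.eqEsubset !subcube_sub.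
  by rewrite finset.setCS => /andP[/fintype.subsetP/(_ j)]; rewrite !inE eqxx => /(_ isT)/eqP.
apply: card_eq_trans (inj_card_eq _) _; last by rewrite card_eq_sym card_II.
by move=> j k _ _ E; apply: injG; rewrite -(He j).2 E (He k).2.
Qed.

End CombinatorialCube.

(** * Direction spaces of Bruhat intervals *)

Section BruhatVectors.
Variables (R : realType) (n : nat).
Implicit Types (v w x y z : 'S_n) (i j k l m : 'I_n).

Local Notation pp := (@perm_point R n).
Local Notation swap i j v := (tperm i j * v)%g.

Lemma bruhat_le_leq v w : bruhat_le v w -> (ninv v <= ninv w)%N.
Proof. by case/bruhat_le_ninv/orP => [/ltnW|/eqP ->]. Qed.

Definition root i j : 'rV[R]_n := delta_mx 0 i - delta_mx 0 j.

Lemma rootD i j k : root i j + root j k = root i k.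
Proof. by rewrite /root addrA subrK. Qed.

Lemma pp_swap v i j : i != j ->
  pp (swap i j v) - pp v = ((v j)%:R - (v i)%:R) *: root i j.
Proof.
move=> ij; apply/rowP => m; rewrite !mxE !eqxx /=.
have [->|mi] := eqVneq m i.
  by rewrite swapL (negbTE ij) -!natr1 /=; ring.
have [->|mj] := eqVneq m j; first by rewrite swapR -!natr1 /=; ring.
by rewrite swapD // -!natr1 /=; ring.
Qed.

Definition atoms v w : {set 'S_n} := [set x | bruhat_cover v x && bruhat_le x w]%SET.

Lemma atomsS v w w' : bruhat_le w w' -> atoms v w \subset atoms v w'.
Proof.
move=> ww'; apply/fintype.subsetP => x; rewrite !inE => /andP[-> xw] /=.
exact: bruhat_le_trans ww'.
Qed.

Lemma atom_le v w x : x \in atoms v w -> bruhat_le v x /\ bruhat_le x w.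
Proof. by rewrite inE => /andP[/bruhat_cover_le]. Qed.

Lemma atom_ninv v w x : x \in atoms v w -> ninv x = (ninv v).+1.
Proof. by rewrite inE => /andP[/bruhat_cover_ninv]. Qed.

Definition atom_cone v w (u : 'rV[R]_n) : Prop :=
  exists a : 'S_n -> R, (forall x, 0 <= a x) /\
    u = \sum_(x in atoms v w) a x *: (pp x - pp v).

Lemma atom_coneD v w u u' : atom_cone v w u -> atom_cone v w u' -> atom_cone v w (u + u').
Proof.
move=> [a [a0 ->]] [b [b0 ->]]; exists (fun x => a x + b x); split.
  by move=> x; rewrite addr_ge0.
by rewrite -big_split; apply: eq_bigr => x _; rewrite scalerDl.
Qed.

Lemma atom_cone0 v w : atom_cone v w 0.
Proof.
by exists (fun=> 0); split=> //; rewrite big1 // => x _; rewrite scale0r.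
Qed.

Lemma atom_coneZ v w c u : 0 <= c -> atom_cone v w u -> atom_cone v w (c *: u).
Proof.
move=> c0 [a [a0 ->]]; exists (fun x => c * a x); split.
  by move=> x; rewrite mulr_ge0.
by rewrite scaler_sumr; apply: eq_bigr => x _; rewrite scalerA.
Qed.

Lemma atom_cone_sum v w (I : finType) (P : pred I) (F : I -> 'rV[R]_n) :
  (forall e, P e -> atom_cone v w (F e)) -> atom_cone v w (\sum_(e | P e) F e).
Proof.
by move=> H; apply: (big_ind (atom_cone v w)); [exact: atom_cone0|exact: atom_coneD|].
Qed.

Lemma atom_cone_atom v w x : x \in atoms v w -> atom_cone v w (pp x - pp v).
Proof.
move=> xA; exists (fun y => (y == x)%:R); split; first by move=> y; case: eqP.
rewrite (bigD1 x) //= eqxx scale1r big1 ?addr0 // => y /andP[_ /negbTE->].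
by rewrite scale0r.
Qed.

Lemma atom_cone_root v w i j : (i < j)%N -> (v i < v j)%N ->
  swap i j v \in atoms v w -> atom_cone v w (root i j).
Proof.
move=> ij vij /atom_cone_atom; have nij : i != j by rewrite -val_eqE neq_ltn /= ij.
rewrite pp_swap // => H.
have c0 : 0 < (v j)%:R - (v i)%:R :> R by rewrite subr_gt0 ltr_nat.
rewrite -[root i j]scale1r -(mulVf (lt0r_neq0 c0)) -scalerA.
by apply: atom_coneZ H; rewrite invr_ge0 ltW.
Qed.

(* Start with the cover [x = (i l) v] where [i] is the first position at which
   [v] and [w] differ and [l] is as large as possible: then no step out of [x]
   needs a negative multiple of [x - v] when it is expressed through atoms of [v]. *)
Lemma mem_atom_cone v w : bruhat_le v w -> atom_cone v w (pp w - pp v).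
Proof.
have [N] := ubnP (ninv w - ninv v); elim: N v => // N IH v lt_N vw.
have [->|/exists_first_diff[i [ne_i eq_lt]]] := eqVneq v w.
  by rewrite subrr; apply: atom_cone0.
pose P l := (i < l)%N && (v i < v l)%N && (swap i l v \in atoms v w).
have [j0 [ij0 /andP[vij0 _] _ cov0 le0]] := exists_first_cover vw eq_lt ne_i.
have Pj0 : P j0 by rewrite /P ij0 vij0 inE cov0.
case: (@arg_maxnP _ j0 P (fun l => l : nat) Pj0) => l /andP[/andP[il vil] xA] lmax.
set x := swap i l v in xA *.
have nil : i != l by rewrite -val_eqE neq_ltn /= il.
have [vx xw] := atom_le xA; have invx := atom_ninv xA.
have [|a [a0 E]] := IH x _ xw.
  by have := bruhat_le_leq xw; clear -lt_N invx; lia.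
have -> : pp w - pp v = (pp x - pp v) + (pp w - pp x) by rewrite [RHS]addrC addrA subrK.
apply: atom_coneD; first exact: atom_cone_atom.
rewrite E; apply: atom_cone_sum => y yA; apply: atom_coneZ => //.
have [xy yw] := atom_le yA; have invy := atom_ninv yA; rewrite invx in invy.
move: yA; rewrite inE => /andP[/bruhat_coverP[k [m [km xkm _ Ey]]] _].
have nkm : k != m by rewrite -val_eqE neq_ltn /= km.
have ik : (i <= k)%N.
  (* A step moving a position before [i] would make [y] differ from [x] there, while the whole
     interval agrees with [v] before [i]. *)
  rewrite leqNgt; apply/negP => ki.
  have xk := bruhat_between_first vx xw eq_lt ki.
  have := bruhat_between_first (bruhat_le_trans vx xy) yw eq_lt ki.
  by rewrite -xk Ey swapL => /perm_inj/eqP; rewrite eq_sym (negbTE nkm).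
have Eyx : pp y - pp x = ((x m)%:R - (x k)%:R) *: root k m by rewrite Ey pp_swap.
have c0 : 0 <= (x m)%:R - (x k)%:R :> R by rewrite subr_ge0 ler_nat ltnW.
have inA z : bruhat_cover v z -> bruhat_le z y -> z \in atoms v w.
  by move=> vz zy; rewrite inE vz; apply: bruhat_le_trans yw.
rewrite Eyx; apply: atom_coneZ => //.
have [[vkm cov le]|[Eki lm vlm cov le]|[lm vim cov le]] := diamond_last il vil km ik xkm Ey invy.
- by apply: atom_cone_root => //; apply: inA.
- rewrite Eki -(rootD i l m); apply: atom_coneD; first exact: atom_cone_root.
  by apply: atom_cone_root => //; apply: inA.
- have /lmax : P m by rewrite /P (ltn_trans il lm) vim inA.
  by rewrite /= leqNgt lm.
Qed.

Definition Dir v w : {vspace 'rV[R]_n} :=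
  spanf (fun z => pp z - pp v) (bruhat_interval v w).

Lemma mem_interval v w z : (z \in bruhat_interval v w) = bruhat_le v z && bruhat_le z w.
Proof. by rewrite inE. Qed.

Lemma Dir_mem v w z : bruhat_le v z -> bruhat_le z w -> pp z - pp v \in Dir v w.
Proof.
by move=> vz zw; apply: (mem_spanf (fun z => pp z - pp v)); rewrite mem_interval vz.
Qed.

Lemma Dir_memB v w y z : bruhat_le v y -> bruhat_le y w -> bruhat_le v z ->
  bruhat_le z w -> pp z - pp y \in Dir v w.
Proof.
move=> vy yw vz zw; have -> : pp z - pp y = (pp z - pp v) - (pp y - pp v).
  by rewrite opprB addrA subrK.
by rewrite memvB // Dir_mem.
Qed.

Lemma Dir_subv v w (U : {vspace 'rV[R]_n}) :
  (forall z, bruhat_le v z -> bruhat_le z w -> pp z - pp v \in U) -> (Dir v w <= U)%VS.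
Proof.
by move=> H; apply: spanf_subv => z; rewrite mem_interval => /andP[]; apply: H.
Qed.

Lemma DirS v w v' w' : bruhat_le v v' -> bruhat_le v' w' -> bruhat_le w' w ->
  (Dir v' w' <= Dir v w)%VS.
Proof.
move=> vv v'w' ww; apply: Dir_subv => z v'z zw'.
apply: Dir_memB => //; first exact: bruhat_le_trans ww.
  exact: bruhat_le_trans v'z.
exact: bruhat_le_trans ww.
Qed.

Lemma vlineZ (c : R) (u : 'rV[R]_n) : c != 0 -> <[c *: u]>%VS = <[u]>%VS.
Proof.
move=> c0; apply/eqP; rewrite eqEsubv -!memvE memvZ ?memv_line //=.
by rewrite -[X in X \in _](scalerK c0) memvZ ?memv_line.
Qed.

Lemma vline_addl (a b : 'rV[R]_n) : (<[a]> + <[b]> = <[a]> + <[a + b]>)%VS.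
Proof.
apply/eqP; rewrite eqEsubv !subv_add -!memvE.
have ma (c : 'rV[R]_n) : a \in (<[a]> + <[c]>)%VS.
  by apply: subvP (memv_line _); apply: addvSl.
have mb (c : 'rV[R]_n) : c \in (<[a]> + <[c]>)%VS.
  by apply: subvP (memv_line _); apply: addvSr.
rewrite !ma /= memvD // andbT -[X in X \in _](addKr a) addrC.
by rewrite memvB.
Qed.

Lemma vline_addr (a b : 'rV[R]_n) : (<[a]> + <[b]> = <[a + b]> + <[b]>)%VS.
Proof. by rewrite addvC vline_addl addvC addrC. Qed.

Lemma cover_line v x i j : (i < j)%N -> (v i < v j)%N -> x = swap i j v ->
  <[pp x - pp v]>%VS = <[root i j]>%VS.
Proof.
move=> ij vij ->; rewrite pp_swap; last by rewrite -val_eqE neq_ltn /= ij.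
by rewrite vlineZ // subr_eq0 eqr_nat gtn_eqF.
Qed.

Lemma cover_empty v i l m : (i < l)%N -> (v i < v l)%N ->
  ninv (swap i l v) = (ninv v).+1 -> (i < m < l)%N -> ~~ (v i < v m < v l)%N.
Proof.
move=> il vil + im; rewrite ninv_tperm // => E; apply/negP => vm.
by move: E; rewrite (bigD1 m) //= im vm; lia.
Qed.

Lemma exists_atom v w : bruhat_le v w -> v != w -> exists x, x \in atoms v w.
Proof.
move=> vw /exists_first_diff[i [ne_i eq_lt]].
have [j [_ _ _ cov le]] := exists_first_cover vw eq_lt ne_i.
by exists (swap i j v); rewrite inE cov.
Qed.

(* All atoms are linked, through common covers, to the first swap of [v]
   towards [w], and two atoms with a common cover span the same space with it. *)
Lemma Dir_atom v w x : x \in atoms v w ->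
  (Dir v w <= <[pp x - pp v]> + Dir x w)%VS.
Proof.
have [N] := ubnP (ninv w - ninv v); elim: N v x => // N IH v x lt_N xA.
pose E x := (<[pp x - pp v]> + Dir x w)%VS; rewrite -/(E x).
have ltx z : z \in atoms v w -> (ninv w - ninv z < N)%N.
  by move=> zA; have := atom_ninv zA; have [_ /bruhat_le_leq] := atom_le zA; lia.
have DirE z y : z \in atoms v w -> y \in atoms z w ->
    Dir z w = (<[pp y - pp z]> + Dir y w)%VS.
  move=> zA yA; apply/eqP; rewrite eqEsubv IH ?ltx //= subv_add -memvE.
  have [zy yw] := atom_le yA.
  rewrite Dir_mem //=; apply: DirS => //; exact: bruhat_le_refl.
have link z z' y : z \in atoms v w -> z' \in atoms v w -> y \in atoms z w ->
    y \in atoms z' w ->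
    (<[pp z - pp v]> + <[pp y - pp z]> = <[pp z' - pp v]> + <[pp y - pp z']>)%VS ->
    E z = E z'.
  move=> zA z'A yA y'A Ezz'.
  by rewrite /E (DirE z y) // (DirE z' y) // !addvA Ezz'.
have [vx xw] := atom_le xA; have vw := bruhat_le_trans vx xw.
have nvw : v != w.
  by apply: contraTneq (xw) => <-; apply/negP => /bruhat_le_leq; rewrite (atom_ninv xA) ltnn.
have [i [ne_i eq_lt]] := exists_first_diff nvw.
have [j [ij /andP[vij vjw] nom cov0 le0]] := exists_first_cover vw eq_lt ne_i.
have x0A : swap i j v \in atoms v w by rewrite inE cov0.
have eqx z m : z \in atoms v w -> (m < i)%N -> z m = v m.
  by move=> zA; have [vz zw] := atom_le zA; apply: bruhat_between_first eq_lt _.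
have diamond z y k l (p : 'I_n) : z = swap k l v -> z \in atoms v w -> (k < l)%N -> (v k < v l)%N ->
    (i < p)%N -> (z i < z p)%N -> y = swap i p z -> y \in atoms z w ->
    (i < k)%N || ((i == k) && (p < l)%N) ->
    exists j', [/\ (i < j')%N, swap i j' v \in atoms v w, E z = E (swap i j' v)
                & (i == k) -> j' = p].
  move=> Ez zA kl vkl ip zip Ey yA cond.
  have invy : ninv y = (ninv v).+2 by rewrite (atom_ninv yA) (atom_ninv zA).
  have zip' := zip; rewrite {1 2}Ez in zip'; have Ey' := Ey; rewrite Ez in Ey'.
  have [j' [r [s [ij' cov cov' [vij' rs rs' Ey2] shape]]]] :=
    diamond_first kl vkl ip zip' Ey' invy cond.
  have [_ yw] := atom_le yA.
  have yA' : y \in atoms (swap i j' v) w by rewrite inE cov'.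
  have zA' : swap i j' v \in atoms v w.
    by rewrite inE cov; apply: bruhat_le_trans (bruhat_cover_le cov') yw.
  exists j'; split=> //; last first.
    move=> /eqP Eik.
    case: shape => [[]|[E1 _ _ _]|[E1 _ _ _]|[[E1 _ _ _]|[]]] //.
    - by move: ip; rewrite E1 -Eik ltnn.
    - by move: ip; rewrite E1 -Eik ltnn.
    - by move: cond; rewrite E1 Eik !ltnn andbF.
  apply: (link _ _ y) => //.
  rewrite (cover_line kl vkl Ez) (cover_line ip zip Ey) (cover_line ij' vij' erefl).
  rewrite (cover_line rs rs' Ey2).
  case: shape => [[-> -> ->]|[-> -> -> ->]|[-> -> -> ->]|[[-> -> -> ->]|[-> -> -> ->]]].
  - by rewrite addvC.
  - by rewrite addvC vline_addl rootD.
  - by rewrite addvC vline_addr rootD.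
  - by rewrite addvC -(rootD i k l) -vline_addr.
  - by rewrite -(rootD k p l) addvC -vline_addl.
(* Atoms that move [i]: minimality of [j] gives [j < l], and the cover condition then gives
   [v l < v j]. *)
have first_link l : (i < l)%N -> swap i l v \in atoms v w -> E (swap i l v) = E (swap i j v).
  have [->//|nlj] := eqVneq l j; move=> il zA; set z := swap i l v in zA *.
  have [vz zw] := atom_le zA.
  have vil : (v i < v l)%N.
    have := bruhat_le_first vz (i := i) (fun m mi => esym (eqx z m zA mi)).
    by rewrite swapL leq_eqVlt val_eqE (inj_eq perm_inj) => /orP[/eqP E0|//]; move: il; rewrite E0 ltnn.
  have vlw : (v l <= w i)%N.
    have := bruhat_le_first zw (i := i); rewrite swapL; apply=> m mi.
    by rewrite (eqx z) // eq_lt.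
  have jl : (j < l)%N.
    rewrite ltn_neqAle eq_sym nlj /= leqNgt; apply/negP => lj.
    by have := nom l; rewrite il lj vil vlw => /(_ isT).
  have vlj : (v l < v j)%N.
    have := cover_empty il vil (atom_ninv zA) (m := j); rewrite ij jl vij -leqNgt => /(_ isT).
    by rewrite leq_eqVlt val_eqE (inj_eq perm_inj) (negbTE nlj).
  have nji : j != i by rewrite -val_eqE neq_ltn /= ij orbT.
  have zj : z j = v j by rewrite swapD // eq_sym.
  have zi : z i = v l by rewrite swapL.
  (* From [z] the first swap towards [w] again exchanges [i] and [j]; the diamond on it replaces [l]
     by [j]. *)
  have [||||cov le] := @first_swap_cover _ z w i j zw.
  - by move=> m mi; rewrite (eqx z) // eq_lt.
  - by [].
  - by rewrite zi zj vlj.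
  - move=> m /andP[im mj]; rewrite zi swapD -?val_eqE ?neq_ltn /= ?im ?(ltn_trans mj jl) ?orbT //.
    have := nom m; rewrite im mj => /(_ isT); apply: contra => /andP[lm mw].
    by rewrite (ltn_trans vil lm).
  have yA : swap i j z \in atoms z w by rewrite inE cov.
  have zij : (z i < z j)%N by rewrite zi zj.
  have cond : (i < i)%N || (i == i) && (j < l)%N by rewrite eqxx jl orbT.
  have [j' [_ _ -> /(_ (eqxx i)) -> //]] :=
    diamond z (swap i j z) i l j erefl zA il vil ij zij erefl yA cond.
(* An atom that fixes [i] still first differs from [w] at [i]; the diamond on its first swap leads
   to an atom moving [i]. *)
have all_link z : z \in atoms v w -> E z = E (swap i j v).
  move=> zA; move: (zA); rewrite inE => /andP[/bruhat_coverP[k [l [kl vkl _ Ez]]] zw].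
  have ik : (i <= k)%N.
    rewrite leqNgt; apply/negP => ki; have := eqx z k zA ki.
    rewrite Ez swapL => /perm_inj E0; by move: kl; rewrite E0 ltnn.
  have [Eki|nki] := eqVneq i k; first by subst k; rewrite Ez first_link // -Ez.
  have ltik : (i < k)%N by rewrite ltn_neqAle val_eqE nki.
  have zi : z i = v i by rewrite Ez swapD // -val_eqE neq_ltn /= (ltn_trans ltik kl).
  have eqzw m : (m < i)%N -> z m = w m by move=> mi; rewrite (eqx z) // eq_lt.
  have nzw : z i != w i by rewrite zi.
  have [p [ip /andP[zip _] _ cov le]] := exists_first_cover zw eqzw nzw.
  have yA : swap i p z \in atoms z w by rewrite inE cov.
  have cond : (i < k)%N || (i == k) && (p < l)%N by rewrite ltik.
  have [j' [ij' j'A -> _]] := diamond z _ k l p Ez zA kl vkl ip zip erefl yA cond.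
  exact: first_link.
apply: Dir_subv => z vz zw; have [->|nvz] := eqVneq z v; first by rewrite subrr mem0v.
rewrite eq_sym in nvz; have [x' x'A] := exists_atom vz nvz.
have [vx' x'z] := atom_le x'A.
have {}x'A : x' \in atoms v w by apply: (fintype.subsetP (atomsS v zw)).
rewrite (all_link x xA) -(all_link x' x'A).
have -> : pp z - pp v = (pp x' - pp v) + (pp z - pp x') by rewrite [RHS]addrC addrA subrK.
by rewrite memv_add ?memv_line // Dir_mem.
Qed.

Lemma Dirvv v : Dir v v = 0%VS.
Proof.
apply/eqP; rewrite -subv0; apply: Dir_subv => z vz zv.
by rewrite (bruhat_le_anti zv vz) subrr mem0v.
Qed.

Lemma Dir_cover v x : bruhat_cover v x -> Dir v x = <[pp x - pp v]>%VS.
Proof.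
move=> vx; have le_vx := bruhat_cover_le vx; apply/eqP; rewrite eqEsubv.
have xA : x \in atoms v x by rewrite inE vx bruhat_le_refl.
by rewrite -[X in (_ <= X)%VS](addv0) -(Dirvv x) Dir_atom // -memvE Dir_mem ?bruhat_le_refl.
Qed.

Lemma Dir_add v z w : bruhat_le v z -> bruhat_le z w ->
  Dir v w = (Dir v z + Dir z w)%VS.
Proof.
move=> vz zw; apply/eqP; rewrite eqEsubv subv_add !DirS ?bruhat_le_refl //= andbT.
have [N] := ubnP (ninv z - ninv v); elim: N v vz => // N IH v vz lt_N.
have [->|nvz] := eqVneq v z; first by rewrite Dirvv add0v subvv.
have [x xA] := exists_atom vz nvz; have [vx xz] := atom_le xA.
have xA' : x \in atoms v w by apply: (fintype.subsetP (atomsS v zw)).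
apply: subv_trans (Dir_atom xA') _; rewrite subv_add -memvE.
rewrite (subvP (addvSl _ _)) ?Dir_mem //=.
have ltx : (ninv z - ninv x < N)%N.
  by have := atom_ninv xA; have := bruhat_le_leq xz; lia.
apply: subv_trans (IH x xz ltx) _.
by rewrite addvS ?subvv // DirS ?bruhat_le_refl.
Qed.

Lemma dim_Dir_le v w : bruhat_le v w -> (\dim (Dir v w) <= ninv w - ninv v)%N.
Proof.
have [N] := ubnP (ninv w - ninv v); elim: N v => // N IH v lt_N vw.
have [->|nvw] := eqVneq v w; first by rewrite Dirvv dimv0.
have [x xA] := exists_atom vw nvw; have [vx xw] := atom_le xA.
apply: leq_trans (dimvS (Dir_atom xA)) _; apply: leq_trans (dimv_add_leqif _ _) _.
have := atom_ninv xA; have := bruhat_le_leq xw => le inv_x.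
have := IH x _ xw; rewrite dim_vline => H.
by apply: leq_trans (leq_add (leq_b1 _) (H _)) _; lia.
Qed.

Definition toric v w := bruhat_le v w /\ \dim (Dir v w) = (ninv w - ninv v)%N.

(** The three pieces from [v] to [x], [y] and [w] have dimensions bounded by their lengths; equality
    in total forces equality in each. *)
Lemma toric_sub v w x y : toric v w -> bruhat_le v x -> bruhat_le x y -> bruhat_le y w ->
  toric x y.
Proof.
move=> [vw dimE] vx xy yw; split=> //.
have vy := bruhat_le_trans vx xy; have xw := bruhat_le_trans xy yw.
apply/eqP; rewrite eqn_leq dim_Dir_le //=.
have := dim_Dir_le vx; have := dim_Dir_le yw.
have := bruhat_le_leq vx; have := bruhat_le_leq xy; have := bruhat_le_leq yw.
have := (dimv_add_leqif (Dir v y) (Dir y w)).1; rewrite -Dir_add // dimE.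
have := (dimv_add_leqif (Dir v x) (Dir x y)).1; rewrite -Dir_add //.
lia.
Qed.

Lemma toric_cap v w z : toric v w -> bruhat_le v z -> bruhat_le z w ->
  (Dir v z :&: Dir z w = 0)%VS.
Proof.
move=> tvw vz zw; apply/eqP; rewrite -dimv_eq0.
have [_ d1] := toric_sub tvw (bruhat_le_refl v) vz zw.
have [_ d2] := toric_sub tvw vz zw (bruhat_le_refl w).
have := dimv_sum_cap (Dir v z) (Dir z w); rewrite -Dir_add // d1 d2.
have [_ ->] := tvw.
have := bruhat_le_leq vz; have := bruhat_le_leq zw; lia.
Qed.

Definition atom_span v (S : {set 'S_n}) : {vspace 'rV[R]_n} :=
  spanf (fun x => pp x - pp v) S.

Lemma Dir_atoms v w : bruhat_le v w -> Dir v w = atom_span v (atoms v w).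
Proof.
move=> vw; apply/eqP; rewrite eqEsubv; apply/andP; split.
  apply: Dir_subv => z vz zw; have [a [_ E]] := mem_atom_cone vz.
  apply: (subvP (spanfS _ (atomsS v zw))).
  by apply/spanfP; exists a.
by apply: spanf_subv => x /atom_le[vx xw]; rewrite Dir_mem.
Qed.

(** * The common sphere and the functionals supporting an interval at its bottom *)

Lemma dotr_pp v w : dotr (pp v) (pp v) = dotr (pp w) (pp w).
Proof.
have S u : dotr (pp u) (pp u) = \sum_(i < n) (i.+1%:R * i.+1%:R).
  rewrite [RHS](reindex_inj (@perm_inj _ u)) /=.
  by apply: eq_bigr => i _; rewrite !mxE.
by rewrite !S.
Qed.

Lemma pp_inj : injective pp.
Proof.
move=> v w /rowP E; apply/permP => i; apply/val_inj/eqP.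
by have := E i; rewrite !mxE => /eqP; rewrite eqr_nat eqSS.
Qed.

Lemma dotr_self_gt0 (d : nat) (x : 'rV[R]_d) : x != 0 -> 0 < dotr x x.
Proof.
move=> x0; rewrite lt_def; apply/andP; split; last first.
  by apply: sumr_ge0 => i _; rewrite -expr2 sqr_ge0.
apply: contra x0; rewrite psumr_eq0 => [/allP H|i _]; last by rewrite -expr2 sqr_ge0.
apply/eqP/rowP => i; have := H i (mem_index_enum _).
by rewrite /= mulf_eq0 orbb mxE => /eqP.
Qed.

Lemma dotr_pp_lt v w : v != w -> dotr (pp v) (pp w) < dotr (pp v) (pp v).
Proof.
move=> nvw; have : pp v - pp w != 0 by rewrite subr_eq0 (inj_eq pp_inj).
move=> /dotr_self_gt0; rewrite dotrB ![dotr (pp v - pp w) _]dotrC !dotrB.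
by rewrite (dotr_pp w v) (dotrC (pp w)); lra.
Qed.

Lemma dotr_sphere v z : dotr (pp z - pp v) (pp z - pp v) = - (2 * dotr (pp v) (pp z - pp v)).
Proof.
rewrite !dotrB ![dotr (pp z - pp v) _]dotrC !dotrB (dotr_pp z v) (dotrC (pp z)).
ring.
Qed.

(* A line meets the sphere containing all the points [pp z] at most twice. *)
Lemma pp_line v x z (c : R) : pp z - pp v = c *: (pp x - pp v) -> z = v \/ z = x.
Proof.
move=> E; have [Exv|nxv] := eqVneq x v.
  by left; apply/pp_inj/eqP; rewrite -subr_eq0 E Exv subrr scaler0.
have d0 : dotr (pp x - pp v) (pp x - pp v) != 0.
  by rewrite gt_eqF // dotr_self_gt0 // subr_eq0 (inj_eq pp_inj).
have H0 := dotr_sphere v x; have := dotr_sphere v z; rewrite E.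
set D := dotr _ _ in H0 d0; set V := dotr _ _ in H0.
rewrite dotrZ [dotr (c *: _) _]dotrC !dotrZ -/D -/V => H1.
have : c * (c - 1) * D = 0.
  have -> : c * (c - 1) * D = c * (c * D) - c * D by ring.
  by rewrite H1 H0; ring.
move=> /eqP; rewrite !mulf_eq0 (negbTE d0) orbF subr_eq0.
case/orP=> /eqP c1; [left|right]; apply/pp_inj/eqP.
  by rewrite -subr_eq0 E c1 scale0r.
by move: E; rewrite c1 scale1r => /addIr->.
Qed.

Lemma atom_extreme v w a : a \in atoms v w ->
  exists c, dotr c (pp a - pp v) = 0 /\
    forall x, x \in atoms v w -> x != a -> dotr c (pp x - pp v) < 0.
Proof.
rewrite inE => /andP[/bruhat_coverP[i [k [ik vik inv_a Ea]]] _].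
(* [h] increases along every step out of [v] other than [(i k)], whose two
   positions are merged in the middle level: since [a] covers [v], no position
   lies strictly between them. *)
pose cl (p : 'I_n) := if (p == i) || (p == k) then 1%N
  else if (p < k)%N && (v p < v k)%N then 0%N else 2%N.
(* The factor [n] keeps the three levels apart, as positions are below [n]; within the outer levels
   the position breaks ties. *)
pose h (p : 'I_n) := (cl p * n + (if cl p == 1 then 0 else p))%N.
pose c : 'rV[R]_n := \row_p (h p)%:R.
have cE (x : 'S_n) (p q : 'I_n) : (p < q)%N -> x = swap p q v ->
    dotr c (pp x - pp v) = ((v q)%:R - (v p)%:R) * ((h p)%:R - (h q)%:R).
  move=> pq ->; rewrite pp_swap; last by rewrite -val_eqE neq_ltn /= pq.
  by rewrite dotrZ dotrB !(dotrC c) !dotr_delta !mxE.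
have nik : k != i by rewrite -val_eqE neq_ltn /= ik orbT.
have cli : cl i = 1%N by rewrite /cl eqxx.
have clk : cl k = 1%N by rewrite /cl eqxx orbT.
exists c; split; first by rewrite (cE a i k) // /h cli clk subrr mulr0.
move=> x xA xa; move: xA; rewrite inE => /andP[/bruhat_coverP[p [q [pq vpq _ Ex]]] _].
rewrite (cE x p q) // pmulr_rlt0 ?subr_gt0 ?ltr_nat // subr_lt0 ltr_nat.
have npq : ~ (p = i /\ q = k) by move=> [Ep Eq]; case/eqP: xa; rewrite Ex Ea Ep Eq.
have n0 : (0 < n)%N by apply: leq_ltn_trans (leq0n i) (ltn_ord i).
have empty m : ~~ ((i < m < k)%N && (v i < v m < v k)%N).
  by apply/negP => /andP[im]; apply/negP; apply: cover_empty.
have lt_p := ltn_ord p; have lt_q := ltn_ord q; move: (empty q) => eq_q; clear empty.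
rewrite /h /cl; have [Epi|npi] := eqVneq p i.
  subst p; have [Eqk|nqk] := eqVneq q k; first by case: npq.
  have nqi : (q == i) = false by rewrite -val_eqE /= gtn_eqF.
  rewrite nqi /=; case: ifP => H; last by rewrite /=; lia.
  by move: eq_q H; rewrite pq vpq /= => /negbTE ->.
have [Epk|npk] := eqVneq p k.
  subst p; have nqi : (q == i) = false by rewrite -val_eqE /= gtn_eqF // (ltn_trans ik).
  have nqk : (q == k) = false by rewrite -val_eqE /= gtn_eqF.
  have nlt : (q < k)%N = false by rewrite ltnNge ltnW.
  by rewrite nqi nqk nlt /=; lia.
rewrite /=; have [Eq|] := boolP ((q == i) || (q == k)).
  have -> : (p < k)%N && (v p < v k)%N.
    case/orP: Eq => /eqP Eq; rewrite Eq in pq vpq; last by rewrite pq.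
    by rewrite (ltn_trans pq ik) (ltn_trans vpq vik).
  by rewrite /= mul0n mul1n add0n addn0.
rewrite negb_or => /andP[nqi nqk]; rewrite /=.
have [Hp|Hp] := boolP ((p < k)%N && (v p < v k)%N); case: ifP => Hq /=; try lia.
Qed.

(** A cover moves a larger value to an earlier position, which lowers the position-weighted sum;
    this functional exposes the vertex [v]. *)
Lemma atom_decreasing v w x : x \in atoms v w ->
  dotr (\row_m (m : nat)%:R) (pp x - pp v) < 0.
Proof.
rewrite inE => /andP[/bruhat_coverP[p [q [pq vpq _ ->]]] _].
rewrite pp_swap; last by rewrite -val_eqE neq_ltn /= pq.
rewrite dotrZ dotrB !(dotrC (\row_m _)) !dotr_delta !mxE.
by rewrite pmulr_rlt0 ?subr_gt0 ?ltr_nat // subr_lt0 ltr_nat.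
Qed.

(** * The Boolean structure of a toric interval with few atoms *)

(** Since the atom vectors span [Dir v w], the second condition makes them a basis of it. *)
Definition cubical v w := toric v w /\ #|atoms v w| = (ninv w - ninv v)%N.

Lemma dim_atom_span v w (S : {set 'S_n}) : cubical v w -> S \subset atoms v w ->
  \dim (atom_span v S) = #|S|.
Proof.
move=> [[vw dimE] cardE] Sw; apply/eqP; rewrite eqn_leq dim_spanf_le /=.
have E : atom_span v (atoms v w) = (atom_span v S + atom_span v (atoms v w :\: S))%VS.
  rewrite /atom_span /spanf (big_setID S) /=; congr (_ + _)%VS.
  apply: eq_bigl => x; rewrite !inE; have /fintype.subsetP/(_ x) := Sw; rewrite inE.
  by case: (x \in S) => [->|]; rewrite ?andbF.
have := dimE; rewrite (Dir_atoms vw) E -cardE => dimS.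
have := (dimv_add_leqif (atom_span v S) (atom_span v (atoms v w :\: S))).1.
have := dim_spanf_le (fun x => pp x - pp v) (atoms v w :\: S).
rewrite -/(atom_span v _) dimS; have := cardsID S (atoms v w).
have -> : atoms v w :&: S = S by apply/finset.setIidPr.
by move=> <- H1 H2; have := leq_trans H2 (leq_add (leqnn _) H1); rewrite leq_add2r.
Qed.

(** The atoms of [[v, z]] are independent, being atoms of [[v, w]], and span [Dir v z], whose
    dimension toricness gives. *)
Lemma cubical_sub v w z : cubical v w -> bruhat_le v z -> bruhat_le z w -> cubical v z.
Proof.
move=> cvw vz zw; have tvz : toric v z.
  by have [t _] := cvw; apply: toric_sub t _ vz zw; apply: bruhat_le_refl.
by split=> //; rewrite -(dim_atom_span cvw (atomsS v zw)) -Dir_atoms //; case: tvz.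
Qed.

Lemma card_atoms v w z : cubical v w -> bruhat_le v z -> bruhat_le z w ->
  #|atoms v z| = (ninv z - ninv v)%N.
Proof. by move=> cvw vz zw; case: (cubical_sub cvw vz zw). Qed.

(** Equal atoms give equal direction spaces, so [pp y' - pp z] lies in [Dir v z] plus the line of
    [pp y - pp z]. Its part in [Dir v z] also lies in [Dir z w], hence is zero, and [pp_line]
    concludes. *)
Lemma cover_atoms_inj v w z y y' : cubical v w -> bruhat_le v z ->
  y \in atoms z w -> y' \in atoms z w -> atoms v y = atoms v y' -> y = y'.
Proof.
move=> [tvw _] vz yA y'A E; have [zy yw] := atom_le yA; have [zy' y'w] := atom_le y'A.
have vy := bruhat_le_trans vz zy; have vy' := bruhat_le_trans vz zy'.
have zw := bruhat_le_trans zy yw.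
have : pp y' - pp z \in Dir v y.
  by rewrite (Dir_atoms vy) E -Dir_atoms // Dir_memB ?bruhat_le_refl.
rewrite (Dir_add vz zy) => /memv_addP[a aD [b bD Eab]].
have a0 : a = 0.
  apply/eqP; rewrite -memv0 -(toric_cap tvw vz zw) memv_cap aD /=.
  have -> : a = (pp y' - pp z) - b by rewrite Eab addrK.
  rewrite memvB ?Dir_mem //; apply: subvP bD; apply: DirS => //; exact: bruhat_le_refl.
move: bD Eab; rewrite a0 add0r Dir_cover; last by move: yA; rewrite inE => /andP[].
move=> /vlineP[c ->] /pp_line[] // E'; by have := atom_ninv y'A; rewrite E' => /n_Sn.
Qed.

Lemma exists_cover_atoms v w z a : cubical v w -> bruhat_le v z -> bruhat_le z w ->
    a \in atoms v w -> a \notin atoms v z ->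
  exists2 y, y \in atoms z w & atoms v y = a |: atoms v z.
Proof.
move=> cvw vz zw aw az; pose D := atoms v w :\: atoms v z.
have cardD : #|D| = (ninv w - ninv z)%N.
  rewrite cardsD (finset.setIidPr (atomsS v zw)) (card_atoms cvw vz zw) cvw.2.
  have := bruhat_le_leq vz; have := bruhat_le_leq zw; lia.
pose f y := atoms v y :\: atoms v z.
have fE y : y \in atoms z w -> atoms v y = f y :|: atoms v z.
  move=> yA; have [zy _] := atom_le yA; apply/setP => x.
  rewrite /f finset.in_setU finset.in_setD; have /fintype.subsetP/(_ x) := atomsS v zy.
  by case: (x \in atoms v z) => [->|_] //; rewrite orbF.
have f1 y : y \in atoms z w -> exists2 b, b \in D & f y = [set b]%SET.
  move=> yA; have [zy yw] := atom_le yA; have vy := bruhat_le_trans vz zy.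
  have : #|f y| == 1%N.
    rewrite cardsD (finset.setIidPr (atomsS v zy)) (card_atoms cvw vz zw).
    rewrite (card_atoms cvw vy yw) (atom_ninv yA); have := bruhat_le_leq vz; lia.
  move=> /cards1P[b Eb]; exists b => //; have : b \in f y by rewrite Eb set11.
  rewrite !finset.in_setD => /andP[-> b_y] /=.
  exact: (fintype.subsetP (atomsS v yw)).
have finj : {in atoms z w &, injective f}.
  move=> y y' yA y'A E; apply: (cover_atoms_inj cvw vz yA y'A).
  by rewrite (fE y) // (fE y') // E.
have sub : f @: atoms z w \subset (@finset.set1 _) @: D.
  by apply/fintype.subsetP => _ /imsetP[y yA ->]; have [b bD ->] := f1 y yA; apply: imset_f.
have : [set a]%SET \in f @: atoms z w.
  (* The vectors of the covers of [z] span [Dir z w], so there are at least [#|D|] covers and the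
     injective [f] reaches every singleton of [D]. *)
  have -> : f @: atoms z w = (@finset.set1 _) @: D.
    apply/eqP; rewrite finset.eqEcard sub (card_in_imset finj) card_imset ?cardD; last exact: finset.set1_inj.
    have [_ <-] := toric_sub cvw.1 vz zw (bruhat_le_refl w).
    by rewrite (Dir_atoms zw) dim_spanf_le.
  by apply: imset_f; rewrite finset.in_setD az.
move=> /imsetP[y yA Ea]; exists y => //.
by rewrite (fE y) // -Ea.
Qed.

Lemma exists_atoms v w (S : {set 'S_n}) : cubical v w -> S \subset atoms v w ->
  exists z, [/\ bruhat_le v z, bruhat_le z w & atoms v z = S].
Proof.
move=> cvw; have [N] := ubnP #|S|; elim: N S => // N IH S ltSN Sw.
have [->|/set0Pn[a aS]] := eqVneq S finset.set0.
  exists v; split; [exact: bruhat_le_refl|by case: cvw => [[]]|].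
  apply/setP => x; rewrite [RHS]inE; apply/negP => xA.
  have [vx xv] := atom_le xA; have := atom_ninv xA.
  by rewrite (bruhat_le_anti xv vx) => /n_Sn.
have [||z [vz zw Ez]] := IH (S :\ a).
- by move: ltSN; rewrite (cardsD1 a) aS.
- exact: fintype.subset_trans (subD1set _ _) Sw.
have aw : a \in atoms v w by apply: (fintype.subsetP Sw).
have [|y yA Ey] := exists_cover_atoms cvw vz zw aw; first by rewrite Ez !inE eqxx.
have [zy yw] := atom_le yA; exists y; split=> //; first exact: bruhat_le_trans zy.
by rewrite Ey Ez finset.setD1K.
Qed.

Lemma bruhat_le_ninv_eq0 v z : bruhat_le v z -> (ninv z - ninv v)%N = 0%N -> z = v.
Proof.
by move=> /bruhat_le_ninv/orP[lt /eqP|/eqP->//]; rewrite subn_eq0 leqNgt lt.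
Qed.

(** Removing one atom yields elements below [z] and [z'] that coincide by induction; then [z] and
    [z'] are covers of the same element, and [cover_atoms_inj] applies. *)
Lemma atoms_inj v w z z' : cubical v w -> bruhat_le v z -> bruhat_le z w ->
  bruhat_le v z' -> bruhat_le z' w -> atoms v z = atoms v z' -> z = z'.
Proof.
move=> cvw; have [N] := ubnP #|atoms v z|; elim: N z z' => // N IH z z' ltN vz zw vz' z'w E.
have cz := card_atoms cvw vz zw; have cz' := card_atoms cvw vz' z'w.
have [A0|/set0Pn[a aA]] := eqVneq (atoms v z) finset.set0.
  rewrite E in A0 cz; rewrite A0 cards0 in cz cz'.
  by rewrite (bruhat_le_ninv_eq0 vz (esym cz)) (bruhat_le_ninv_eq0 vz' (esym cz')).
have cvz := cubical_sub cvw vz zw; have cvz' := cubical_sub cvw vz' z'w.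
have [y [vy yz Ey]] := exists_atoms cvz (subD1set (atoms v z) a).
have [y' [vy' yz' Ey']] := exists_atoms cvz' (subD1set (atoms v z') a).
have yw := bruhat_le_trans yz zw; have yw' := bruhat_le_trans yz' z'w.
have Eyy : y = y'.
  apply: IH => //; last by rewrite Ey Ey' E.
  by move: ltN; rewrite Ey (cardsD1 a) aA.
subst y'; have cy := card_atoms cvw vy yw.
have inA u : bruhat_le y u -> bruhat_le u w -> atoms v u = atoms v z -> u \in atoms y w.
  move=> yu uw Eu; have cu := card_atoms cvw (bruhat_le_trans vy yu) uw.
  rewrite inE /bruhat_cover yu uw /= andbT; move: cu.
  rewrite Eu (cardsD1 a) aA -Ey cy.
  have := bruhat_le_leq vy; have := bruhat_le_leq yu; clear; lia.
exact: (cover_atoms_inj cvw vy (inA z yz zw erefl) (inA z' yz' z'w (esym E))).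
Qed.

Lemma atoms_sub v w z z' : cubical v w -> bruhat_le v z -> bruhat_le z w ->
  bruhat_le v z' -> bruhat_le z' w -> (atoms v z \subset atoms v z') = bruhat_le z z'.
Proof.
move=> cvw vz zw vz' z'w; apply/idP/idP => [sub|]; last exact: atomsS.
have [y [vy yz' Ey]] := exists_atoms (cubical_sub cvw vz' z'w) sub.
by rewrite (atoms_inj cvw vz zw vy (bruhat_le_trans yz' z'w)).
Qed.

Lemma cover_of_card v w y z : cubical v w -> bruhat_le v y -> bruhat_le y z ->
  bruhat_le z w -> #|atoms v z| = #|atoms v y|.+1 -> z \in atoms y w.
Proof.
move=> cvw vy yz zw; have yw := bruhat_le_trans yz zw.
rewrite (card_atoms cvw vy yw) (card_atoms cvw (bruhat_le_trans vy yz) zw).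
rewrite inE /bruhat_cover yz zw andbT /=.
have := bruhat_le_leq vy; have := bruhat_le_leq yz; clear; lia.
Qed.

(** [c] is the coordinate along [a] in the basis of atom vectors, hence at least its value at [v] by
    [mem_atom_cone]. If it took that value at some [z] above [a], take [y] below [z] with all its
    atoms but [a]: then [c] kills [Dir v y] and [pp z - pp y], hence [Dir v z], which contains
    [pp a - pp v]. *)
Lemma facet_avoiding v w a : cubical v w -> a \in atoms v w ->
  exists c b, forall z, bruhat_le v z -> bruhat_le z w ->
    b <= dotr c (pp z) /\ (dotr c (pp z) == b) = (a \notin atoms v z).
Proof.
move=> cvw aw; pose B := atoms v w :\ a.
have aB : pp a - pp v \notin atom_span v B.
  apply/negP => aB; have dimB := dim_atom_span cvw (subD1set _ a : B \subset _).
  have : (atom_span v (atoms v w) <= atom_span v B)%VS.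
    apply: spanf_subv => x xw; have [->//|xa] := eqVneq x a.
    by apply: (mem_spanf (fun x => pp x - pp v)); rewrite finset.in_setD1 xa.
  move=> /dimvS; rewrite dimB (dim_atom_span cvw (fintype.subxx _)).
  by rewrite /B (cardsD1 a (atoms v w)) aw ltnn.
have [c [cB ca]] := separate aB.
have cx x : x \in atoms v w -> x != a -> dotr c (pp x - pp v) = 0.
  move=> xw xa; apply/cB/(mem_spanf (fun x => pp x - pp v)).
  by rewrite finset.in_setD1 xa.
have c0 z : bruhat_le v z -> bruhat_le z w -> a \notin atoms v z -> forall u,
    u \in Dir v z -> dotr c u = 0.
  move=> vz zw az u; rewrite (Dir_atoms vz); apply: dotr_spanf => x xz.
  apply: cx; first exact: (fintype.subsetP (atomsS v zw)).
  by apply: contraNneq az => <-.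
exists c, (dotr c (pp v)) => z vz zw; have [az|az] := boolP (a \in atoms v z); last first.
  have := c0 z vz zw az _ (Dir_mem vz (bruhat_le_refl z)).
  by rewrite dotrB => /eqP; rewrite subr_eq0 => /eqP ->; rewrite lexx eqxx.
have ge0 : 0 <= dotr c (pp z - pp v).
  have [l [l0 ->]] := mem_atom_cone vz; rewrite dotr_sum sumr_ge0 // => x xz.
  have xw := fintype.subsetP (atomsS v zw) _ xz.
  rewrite dotrZ mulr_ge0 //; have [->|xa] := eqVneq x a; first by rewrite ca ler01.
  by rewrite cx.
rewrite dotrB subr_ge0 in ge0; split=> //; apply/negP => /eqP cz.
have [y [vy yz Ey]] := exists_atoms (cubical_sub cvw vz zw) (subD1set (atoms v z) a).
have yw := bruhat_le_trans yz zw.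
have ay : a \notin atoms v y by rewrite Ey !inE eqxx.
have cy : dotr c (pp y) = dotr c (pp v).
  have := c0 y vy yw ay _ (Dir_mem vy (bruhat_le_refl y)).
  by rewrite dotrB => /eqP; rewrite subr_eq0 => /eqP.
have zA : z \in atoms y w.
  by apply: (cover_of_card cvw vy yz zw); rewrite Ey (cardsD1 a (atoms v z)) az.
have [va az'] := atom_le az.
have cyz : bruhat_cover y z by move: zA; rewrite inE => /andP[].
have := Dir_mem va az'; rewrite (Dir_add vy yz) (Dir_cover cyz).
move=> /memv_addP[u uD [u' /vlineP[t ->] E]].
move: ca; rewrite E dotrD (c0 y vy yw ay u uD) dotrZ dotrB cz cy subrr mulr0 addr0.
by move=> /eqP; rewrite eq_sym oner_eq0.
Qed.

(** [c] vanishes on [Dir a w] and is positive at [v] relative to [a]. Positivity is carried up one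
    atom [b] at a time, from [y] to [z], through the quadrilateral completed by [y1] and [z1], the
    elements obtained from [y] and [z] by adding the atom [a], where [c] is already known to vanish
    relative to [a]. *)
Lemma facet_containing v w a : cubical v w -> a \in atoms v w ->
  exists c b, forall z, bruhat_le v z -> bruhat_le z w ->
    b <= dotr c (pp z) /\ (dotr c (pp z) == b) = (a \in atoms v z).
Proof.
move=> cvw aw; have [va a_w] := atom_le aw; have cva : bruhat_cover v a.
  by move: aw; rewrite inE => /andP[].
have nva : pp v - pp a != 0.
  rewrite subr_eq0 (inj_eq pp_inj); apply/eqP => E.
  by have := bruhat_cover_ninv cva; rewrite E => /n_Sn.
have aD : pp v - pp a \notin Dir a w.
  apply: contra nva => vD; rewrite -memv0 -(toric_cap cvw.1 va a_w) memv_cap vD andbT.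
  by apply: Dir_memB => //; exact: bruhat_le_refl.
have [c [cD cv]] := separate aD.
have mem_a z : bruhat_le z w -> (a \in atoms v z) = bruhat_le a z.
  by move=> zw; rewrite inE cva.
have c_eq z : bruhat_le z w -> a \in atoms v z -> dotr c (pp z - pp a) = 0.
  by move=> zw; rewrite mem_a // => az; apply/cD/Dir_mem.
suff c_gt z : bruhat_le v z -> bruhat_le z w -> a \notin atoms v z -> 0 < dotr c (pp z - pp a).
  exists c, (dotr c (pp a)) => z vz zw; have [az|az] := boolP (a \in atoms v z).
    by have /eqP := c_eq z zw az; rewrite dotrB subr_eq0 => /eqP ->; rewrite lexx eqxx.
  have := c_gt z vz zw az; rewrite dotrB subr_gt0 => lt.
  by rewrite ltW // gt_eqF.
have [N] := ubnP #|atoms v z|; elim: N z => // N IH z ltN vz zw az.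
have [A0|/set0Pn[b bz]] := eqVneq (atoms v z) finset.set0.
  have := card_atoms cvw vz zw; rewrite A0 cards0 => /esym/(bruhat_le_ninv_eq0 vz) ->.
  by rewrite cv ltr01.
have ab : a != b by apply: contraNneq az => ->.
have [y [vy yz Ey]] := exists_atoms (cubical_sub cvw vz zw) (subD1set (atoms v z) b).
have yw := bruhat_le_trans yz zw.
have Ez : atoms v z = b |: atoms v y by rewrite Ey finset.setD1K.
have b_y : b \notin atoms v y by rewrite Ey !inE eqxx.
have ay : a \notin atoms v y by rewrite Ey finset.in_setD1 negb_and az orbT.
have cy : 0 < dotr c (pp y - pp a).
  by apply: IH => //; move: ltN; rewrite Ez cardsU1 b_y.
have [y1 y1A Ey1] := exists_cover_atoms cvw vy yw aw ay.
have [z1 z1A Ez1] := exists_cover_atoms cvw vz zw aw az.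
have [yy1 y1w] := atom_le y1A; have [zz1 z1w] := atom_le z1A.
have vy1 := bruhat_le_trans vy yy1; have vz1 := bruhat_le_trans vz zz1.
have y1z1 : bruhat_le y1 z1.
  by rewrite -(atoms_sub cvw vy1 y1w vz1 z1w) Ey1 Ez1 finset.setUS // Ez finset.subsetUr.
have yz1 := bruhat_le_trans yz zz1.
have zA : z \in atoms y w.
  by apply: (cover_of_card cvw vy yz zw); rewrite Ez cardsU1 b_y.
have nzy1 : z != y1 by apply: contraNneq az => ->; rewrite Ey1 !inE eqxx.
(* A cover of [y] below [z1] gains exactly one atom, which can only be [a] or [b]. *)
have atoms_yz1 : atoms y z1 = [set z; y1]%SET.
  apply/setP => x; rewrite !inE; apply/idP/idP => [xA|].
    have {}xA : x \in atoms y z1 by rewrite inE.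
    have [yx xz1] := atom_le xA; have xw := bruhat_le_trans xz1 z1w.
    have vx := bruhat_le_trans vy yx.
    have cardx : #|atoms v x| = #|atoms v y|.+1.
      rewrite (card_atoms cvw vx xw) (card_atoms cvw vy yw) (atom_ninv xA).
      by have := bruhat_le_leq vy; clear; lia.
    have sub : atoms v x \subset a |: (b |: atoms v y) by rewrite -Ez -Ez1 atomsS.
    have [e ex ey] : exists2 e, e \in atoms v x & e \notin atoms v y.
      apply/exists_inP; apply: contraT; rewrite negb_exists_in => /forall_inP H.
      have /subset_leq_card : atoms v x \subset atoms v y.
        by apply/fintype.subsetP => e ex; have := H e ex; rewrite negbK.
      by rewrite cardx ltnn.
    have Ex : atoms v x = e |: atoms v y.
      apply/eqP; rewrite eq_sym finset.eqEcard cardsU1 ey cardx leqnn andbT.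
      by rewrite finset.subUset finset.sub1set ex atomsS.
    have := fintype.subsetP sub e ex; rewrite !inE -/(atoms v y).
    have -> : bruhat_cover v e && bruhat_le e y = false by move: ey; rewrite inE => /negbTE.
    rewrite orbF => /orP[/eqP ea|/eqP eb].
      by rewrite (atoms_inj cvw vx xw vy1 y1w) ?eqxx ?orbT // Ex Ey1 ea.
    by rewrite (atoms_inj cvw vx xw vz zw) ?eqxx // Ex Ez eb.
  move=> /orP[]/eqP ->; rewrite ?zz1 ?y1z1 andbT.
    by move: zA; rewrite inE => /andP[].
  by move: y1A; rewrite inE => /andP[].
have [l [l0]] := mem_atom_cone yz1.
rewrite atoms_yz1 big_setU1 ?inE //= big_set1 => E.
set al := l z in E; set be := l y1 in E.
have al0 : 0 <= al := l0 z; have be0 : 0 <= be := l0 y1.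
have cz1 : dotr c (pp z1 - pp a) = 0 by apply: c_eq; rewrite // Ez1 !inE eqxx.
have cy1 : dotr c (pp y1 - pp a) = 0 by apply: c_eq; rewrite // Ey1 !inE eqxx.
have nz1 u : bruhat_le v u -> bruhat_le u w -> (#|atoms v u| < #|atoms v z1|)%N -> z1 != u.
  by move=> vu uw lt; apply: contraTneq lt => ->; rewrite ltnn.
have cardz1 : #|atoms v z1| = #|atoms v y|.+2.
  by rewrite Ez1 cardsU1 az Ez cardsU1 b_y.
have dy : dotr (pp z1) (pp y) < dotr (pp z1) (pp z1).
  by apply/dotr_pp_lt/nz1; rewrite // cardz1.
have dz : dotr (pp z1) (pp z) < dotr (pp z1) (pp z1).
  by apply/dotr_pp_lt/nz1; rewrite // cardz1 Ez cardsU1 b_y.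
have dy1 : dotr (pp z1) (pp y1) < dotr (pp z1) (pp z1).
  by apply/dotr_pp_lt/nz1; rewrite // cardz1 Ey1 cardsU1 ay.
have dotE e : dotr e (pp z1 - pp y) =
    al * dotr e (pp z - pp y) + be * dotr e (pp y1 - pp y).
  by rewrite E [LHS]dotrD !dotrZ.
(* Otherwise [z1] would lie in the triangle [y z y1], which is impossible as
   all the points lie on a common sphere. *)
have albe : 1 < al + be.
  rewrite ltNge; apply/negP => le1; have := dotE (pp z1).
  rewrite !dotrB; set t := dotr _ (pp z1) in dy dz dy1 *.
  rewrite -subr_gt0 in dy; rewrite -subr_gt0 in dz; rewrite -subr_gt0 in dy1; move=> Et.
  have al1 : 0 <= 1 - al - be by rewrite -addrA -opprD subr_ge0.
  have H1 := mulr_ge0 al0 (ltW dz); have H2 := mulr_ge0 be0 (ltW dy1).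
  have H3 := mulr_ge0 al1 (ltW dy).
  have [al_gt0|al_le0] := ltP 0 al; first by have := mulr_gt0 al_gt0 dz; lra.
  have [be_gt0|be_le0] := ltP 0 be; first by have := mulr_gt0 be_gt0 dy1; lra.
  have {}al0 : al = 0 by apply/le_anti/andP.
  have {}be0 : be = 0 by apply/le_anti/andP.
  by move: Et dy; rewrite al0 be0 !mul0r addr0 => ->; rewrite ltxx.
have := dotE c.
have dB u u' : dotr c (pp u - pp u') = dotr c (pp u - pp a) - dotr c (pp u' - pp a).
  by rewrite !dotrB opprB addrA subrK.
rewrite !(dB _ y) cz1 cy1; set g := dotr c (pp y - pp a) in cy *.
set h := dotr c (pp z - pp a) => Eg.
(* With the values at [y1] and [z1] zero, the relation of the quadrilateral ties the sign at [z] to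
   that at [y]. *)
have Eh : al * h = g * (al + be - 1) by move: Eg; lra.
have : 0 < al * h by rewrite Eh mulr_gt0 // subr_gt0.
have [->|aln0] := eqVneq al 0; first by rewrite mul0r ltxx.
by rewrite pmulr_rgt0 // lt_def aln0.
Qed.

Lemma cubical_comb_equiv v w : cubical v w ->
  comb_equiv (bruhat_polytope R v w) (cube R #|atoms v w|).
Proof.
move=> cvw; have vw : bruhat_le v w by case: cvw => [[]].
set m := #|atoms v w|; pose at_ : 'I_m -> 'S_n := enum_val.
have at_inj : injective at_ := enum_val_inj.
have atP (j : 'I_m) : at_ j \in atoms v w := enum_valP j.
have /choice[f Hf] (S : {set 'I_m}) :
    exists z, [/\ bruhat_le v z, bruhat_le z w & atoms v z = at_ @: S].
  by apply: (exists_atoms cvw); apply/fintype.subsetP => _ /imsetP[j _ ->].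
have at_f (j : 'I_m) S : (at_ j \in atoms v (f S)) = (j \in S).
  by have [_ _ ->] := Hf S; rewrite mem_imset.
have E : bruhat_polytope R v w = hull (fun S => pp (f S)) [set: {set 'I_m}]%SET.
  congr conv_hull; apply/seteqP; split=> _ [z /= zI <-]; last first.
    by exists (f z) => //; have [vz zw _] := Hf z; rewrite /= mem_interval vz.
  move: zI; rewrite mem_interval => /andP[vz zw].
  exists (at_ @^-1: atoms v z)%SET; first by rewrite /= inE.
  have [vz' z'w Ef] := Hf (at_ @^-1: atoms v z)%SET.
  congr pp; apply: (atoms_inj cvw) => //; rewrite Ef; apply/setP => x.
  apply/imsetP/idP => [[j + ->]|xz]; first by rewrite inE.
  have xw := fintype.subsetP (atomsS v zw) _ xz.
  exists (enum_rank_in xw x); last by rewrite /at_ enum_rankK_in.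
  by rewrite inE /at_ enum_rankK_in.
rewrite E cube_hull; apply: comb_equiv_facesets => T; rewrite cube_facesets.
apply: (@cubelike_facesets _ _ _ _ (Dir v w)) => [|S S'|j b].
- by rewrite (Dir_atoms vw) dim_spanf_le.
- by have [? ? _] := Hf S; have [? ? _] := Hf S'; apply: Dir_memB.
- case: b.
    have [c [b H]] := facet_containing cvw (atP j); exists c, b => S.
    by have [vz zw _] := Hf S; have [-> ->] := H _ vz zw; rewrite at_f; case: (j \in S).
  have [c [b H]] := facet_avoiding cvw (atP j); exists c, b => S.
  by have [vz zw _] := Hf S; have [-> ->] := H _ vz zw; rewrite at_f; case: (j \in S).
Qed.

(** * Dimension of an interval polytope and its edges at the bottom vertex *)

Lemma has_dim_diff d (I : finType) (p : I -> 'rV[R]_d) (T : {set I}) (i0 : I) : i0 \in T ->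
  has_dim (hull p T) (\dim (spanf (fun i : I => p i - p i0) T)).
Proof. by move=> i0T; exists (p i0), (spanf (fun i : I => p i - p i0) T); rewrite -aff_hull_diff. Qed.

Lemma has_dim_uniq d (I : finType) (p : I -> 'rV[R]_d) (T : {set I}) (k k' : nat) :
  has_dim (hull p T) k -> has_dim (hull p T) k' -> k = k'.
Proof. by move=> /has_dim_hull dim_k /has_dim_hull dim_k'; apply: succn_inj; rewrite -dim_k. Qed.

Lemma has_dim_Dir v w : bruhat_le v w -> has_dim (bruhat_polytope R v w) (\dim (Dir v w)).
Proof. by move=> vw; apply: has_dim_diff; rewrite mem_interval bruhat_le_refl. Qed.

(** The description of faces by [faceset] takes a whole type of generators, so an interval is made
    into a subtype. *)
Lemma hull_sig d (I : finType) (p : I -> 'rV[R]_d) (T : {set I}) :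
  hull p T = hull (fun i : {i | i \in T} => p (val i)) [set: {i | i \in T}]%SET.
Proof.
congr conv_hull; apply/seteqP; split=> _ [i /= iT <-].
  by exists (exist _ i iT); rewrite /= ?inE.
by exists (val i) => //; apply: (valP i).
Qed.

(** [atom_decreasing] isolates [v], and [atom_extreme] isolates the segment from [v] to an atom, so
    the atoms inject into the edges at [v]. *)
Lemma card_atoms_le v w d : bruhat_le v w ->
    is_vertex (bruhat_polytope R v w) (pp v) /\
    (([set E | is_edge (bruhat_polytope R v w) E /\ E (pp v)] #= `I_d)%card ->
     (#|atoms v w| <= d)%N).
Proof.
move=> vw; pose I := {z | z \in bruhat_interval v w}; pose p (z : I) := pp (val z).
have QE : bruhat_polytope R v w = hull p [set: I]%SET := hull_sig _ _.
have vI : v \in bruhat_interval v w by rewrite mem_interval bruhat_le_refl.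
pose v' : I := exist _ v vI.
have zI (z : I) : bruhat_le v (val z) /\ bruhat_le (val z) w.
  by have := valP z; rewrite mem_interval => /andP.
(* By [mem_atom_cone], a functional that is nonpositive on the atoms is
   maximized at [v], and only combinations of the atoms it kills are added. *)
have cone c (z : I) : (forall x, x \in atoms v w -> dotr c (pp x - pp v) <= 0) ->
    exists l : 'S_n -> R, [/\ p z - pp v = \sum_(x in atoms v w) l x *: (pp x - pp v),
      dotr c (p z) <= dotr c (pp v) & dotr c (p z) = dotr c (pp v) ->
      forall x, x \in atoms v w -> dotr c (pp x - pp v) < 0 -> l x = 0].
  move=> c_le0; have [vz zw] := zI z.
  have [l [l0 E]] : atom_cone v w (p z - pp v).
    have [l [l0 ->]] := mem_atom_cone vz.
    apply: atom_cone_sum => x xz; apply: atom_coneZ => //.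
    exact/atom_cone_atom/(fintype.subsetP (atomsS v zw)).
  have term x : x \in atoms v w -> l x * dotr c (pp x - pp v) <= 0.
    by move=> xA; rewrite mulr_ge0_le0 // c_le0.
  have dE : dotr c (p z) - dotr c (pp v) = \sum_(x in atoms v w) l x * dotr c (pp x - pp v).
    by rewrite -dotrB E dotr_sum; apply: eq_bigr => x _; rewrite dotrZ.
  exists l; split=> //; first by rewrite -subr_le0 dE sumr_le0.
  move=> E0 x xA lt0; have /eqP := dE; rewrite E0 subrr eq_sym -oppr_eq0 -sumrN.
  rewrite psumr_eq0 => [/allP/(_ x)|y yA]; last by rewrite oppr_ge0 term.
  rewrite mem_index_enum xA oppr_eq0 mulf_eq0 (lt_eqF lt0) orbF.
  by move=> /(_ isT)/eqP.
have fv : faceset p [set v']%SET.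
  exists (\row_m (m : nat)%:R), (dotr (\row_m (m : nat)%:R) (pp v)).
  have dec x : x \in atoms v w -> dotr (\row_m (m : nat)%:R) (pp x - pp v) <= 0.
    by move=> xA; rewrite ltW // (atom_decreasing xA).
  split=> [z|]; first by have [l []] := cone _ z dec.
  apply/setP => z; rewrite !inE; apply/eqP/eqP => [->//|Ez].
  have [l [E _ /(_ Ez) l0]] := cone _ z dec.
  apply/val_inj/pp_inj/eqP; rewrite -subr_eq0 [_ - _]E big1 // => x xA.
  by rewrite l0 ?scale0r // (atom_decreasing xA).
have aI a : a \in atoms v w -> a \in bruhat_interval v w.
  by move=> /atom_le[va aw]; rewrite mem_interval va.
pose at_ (j : 'I_#|atoms v w|) : I := exist _ (enum_val j) (aI _ (enum_valP j)).
have fa (j : 'I_#|atoms v w|) : faceset p [set v'; at_ j]%SET.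
  have [c [ca clt]] := atom_extreme (enum_valP j).
  have c_le0 x : x \in atoms v w -> dotr c (pp x - pp v) <= 0.
    move=> xA; have [->|xa] := eqVneq x (enum_val j); first by rewrite ca.
    by rewrite ltW // clt.
  exists c, (dotr c (pp v)); split=> [z|]; first by have [l []] := cone _ z c_le0.
  apply/setP => z; rewrite !inE; apply/idP/eqP => [/orP[]/eqP->//|Ez].
    by apply/eqP; rewrite -subr_eq0 -dotrB; apply/eqP.
  have [l [E _ /(_ Ez) l0]] := cone _ z c_le0.
  (* Only the coefficient of the chosen atom survives, so the point lies on the line through [v] and
     that atom, and [pp_line] leaves only those two points. *)
  have : pp (val z) - pp v = l (enum_val j) *: (pp (enum_val j) - pp v).
    rewrite [LHS]E (bigD1 (enum_val j)) ?enum_valP //= big1 ?addr0 // => x /andP[xA xa].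
    by rewrite l0 ?scale0r // clt.
  by case/pp_line => Ez'; apply/orP; [left|right]; apply/eqP/val_inj.
rewrite QE; split.
  rewrite /is_vertex; have -> : [set pp v] = hull p [set v']%SET.
    apply/seteqP; split=> [_ ->|x /hullP[l [_]]]; first by apply: (@mem_hull _ _ _ p _ v'); rewrite set11.
    by rewrite !big_set1 => -> ->; rewrite scale1r.
  exact: is_face_hull.
move=> cardE; pose e (j : 'I_#|atoms v w|) := hull p [set v'; at_ j]%SET.
have e_inj : injective e.
  move=> j k /(faceset_inj (fa j) (fa k))/setP/(_ (at_ j)); rewrite !inE eqxx orbT.
  move=> /esym/orP[]/eqP/(congr1 val) /= E; last exact: enum_val_inj.
  by have := atom_ninv (enum_valP j); rewrite E => /n_Sn.
have sub : [set e j | j in [set: 'I_#|atoms v w|]] `<=` [set E | is_edge (hull p [set: I]%SET) E /\ E (pp v)].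
  move=> _ [j _ <-] /=; split; last by apply: (@mem_hull _ _ _ p _ v'); rewrite set21.
  split; first exact: is_face_hull.
  have := has_dim_diff p (set21 v' (at_ j)); congr has_dim.
  have nva : pp (enum_val j) - pp v != 0.
    rewrite subr_eq0 (inj_eq pp_inj); apply/eqP => E.
    by have := atom_ninv (enum_valP j); rewrite E => /n_Sn.
  rewrite -[RHS](_ : \dim <[pp (enum_val j) - pp v]> = 1%N); last by rewrite dim_vline nva.
  congr (\dim _); apply/eqP; rewrite eqEsubv; apply/andP; split.
    apply: spanf_subv => z; rewrite !inE => /orP[]/eqP->; first by rewrite subrr mem0v.
    exact: memv_line.
  by rewrite -memvE; have := mem_spanf (fun z : I => p z - p v') (set22 v' (at_ j)).
rewrite -card_le_II -(card_le_eqr cardE).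
apply: card_le_trans (subset_card_le sub).
rewrite (card_le_eqr (inj_card_eq _)) => [|j k _ _]; last exact: e_inj.
by rewrite -(card_le_eqr card_II) card_le_II.
Qed.

End BruhatVectors.

Theorem proposition1p2 (R : realType) (n : nat) (v w : 'S_n)
    (le_vw : bruhat_le v w) (toric_vw : is_toric R v w) :
  is_simple (bruhat_polytope R v w) <->
  exists d : nat, comb_equiv (bruhat_polytope R v w) (cube R d).
Proof.
have tvw : toric R v w.
  split=> //; rewrite -!perm_lengthE.
  exact: has_dim_uniq (has_dim_Dir R le_vw) toric_vw.
split=> [[d [dimQ cardE]]|[d [phi [phi_bij phi_sub]]]].
  exists #|atoms v w|; apply: cubical_comb_equiv; split=> //.
  (* Simplicity is applied at the vertex [v] alone; the opposite inequality holds because the atom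
     vectors span [Dir v w]. *)
  have [vQ le_d] := card_atoms_le R d le_vw.
  have Ed : d = (ninv w - ninv v)%N.
    by rewrite (has_dim_uniq dimQ (has_dim_Dir R le_vw)); case: tvw.
  apply/eqP; rewrite eqn_leq -{1}Ed le_d; last exact: cardE.
  by case: tvw => _ <-; rewrite (Dir_atoms R le_vw) dim_spanf_le.
rewrite cube_hull in phi_bij; rewrite /bruhat_polytope -/(hull _ _) hull_sig in phi_bij phi_sub *.
exact: is_simple_of_cube phi_bij phi_sub.
Qed.
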